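(* Let $\mathcal{S}:\ \dot x=Ax+Bu,\ y=Cx$ with $A\in\mathbb{R}^{n\times n}$, $B\in\mathbb{R}^{n\times m}$, $C\in\mathbb{R}^{k\times n}$, where $A$ is stable, $(A,B)$ is controllable, $(C,A)$ is observable, $B$ has full column rank and $C$ has full row rank. Then the following estimates hold: \begin{itemize} \item peak-to-peak gain: $\|\mathcal{S}\|_{\infty,\infty}\le\|\mathcal{S}\|_{\ast}\le\|\mathcal{S}\|_{\varepsilon}$; \item impulse-to-integral gain: $\|\mathcal{S}\|_{1,i}\le\|\mathcal{S}\|_{\ast'}\le\|\mathcal{S}\|_{\varepsilon}$; \item integral-to-peak gain: $\|\mathcal{S}\|_{\infty,1}\le\|\mathcal{S}\|_{\omega}\le\|\mathcal{S}\|_{\circ}$; \item impulse-to-peak gain: $\|\mathcal{S}\|_{\infty,i}\le\|\mathcal{S}\|_{\omega}\le\|\mathcal{S}\|_{\circ'}$. \end{itemize}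
   Context: A matrix is stable if all its eigenvalues have strictly negative real parts; $\lambda_{\max}$ is the largest eigenvalue of a symmetric matrix; $|\cdot|$ is the Euclidean norm. For measurable $f:[0,T]\to\mathbb{R}^d$, $\|f\|_r=\left(\int_0^T|f(t)|^r\,dt\right)^{1/r}$ for $1\le r<\infty$ and $\|f\|_\infty=\operatorname{ess\,sup}_{t\in[0,T]}|f(t)|$. Gains. For $p\in[1,\infty]$, $\|\mathcal{S}\|_{\infty,p}:=\sup_{T\ge 0}\sup\|y\|_\infty$, where the inner supremum is over measurable $u:[0,T]\to\mathbb{R}^m$ with $\|u\|_p\le 1$, and $y$ is the output of $\mathcal{S}$ on $[0,T]$ with $x(0)=0$. For $q\in[1,\infty]$, $\|\mathcal{S}\|_{q,i}:=\sup_{T\ge 0}\max_{|u_0|\le 1}\|y\|_q$, where $y$ is the output of $\mathcal{S}$ on $[0,T]$ with $x(0)=0$ and impulse input $u(t)=u_0\delta(t)$, $u_0\in\mathbb{R}^m$, i.e. $y(t)=Ce^{At}Bu_0$. Norms. Let $r<0$ be the largest real part of the eigenvalues of $A$. For $\alpha\in(0,-2r)$ let $P_\alpha,Q_\alpha\succ 0$ be the solutions of $$AP_\alpha+P_\alpha A^\top+\alpha P_\alpha+\tfrac1\alpha BB^\top=0,\qquad Q_\alpha A+A^\top Q_\alpha+\alpha Q_\alpha+\tfrac1\alpha C^\top C=0 .$$ Define, with minima over $\alpha\in(0,-2r)$, $$\|\mathcal{S}\|_\ast^2=\min_\alpha\lambda_{\max}(CP_\alpha C^\top),\quad \|\mathcal{S}\|_{\ast'}^2=\min_\alpha\lambda_{\max}(B^\top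 Q_\alpha B),$$ $$\|\mathcal{S}\|_\varepsilon^2=\min_\alpha\operatorname{trace}(CP_\alpha C^\top)=\min_\alpha\operatorname{trace}(B^\top Q_\alpha B).$$ Let $\tilde P$ range over symmetric matrices with $\tilde P\succ 0$, $A\tilde P+\tilde PA^\top\prec 0$, $\tilde P\succeq BB^\top$, and let $\tilde Q$ range over symmetric matrices with $\tilde Q\succ 0$, $\tilde QA+A^\top\tilde Q\prec 0$, $\tilde Q\succeq C^\top C$. Define $$\|\mathcal{S}\|_\omega^2=\inf_{\tilde P}\lambda_{\max}(C\tilde PC^\top)=\inf_{\tilde Q}\lambda_{\max}(B^\top\tilde QB),$$ $$\|\mathcal{S}\|_\circ^2=\inf_{\tilde P}\operatorname{trace}(C\tilde PC^\top),\qquad \|\mathcal{S}\|_{\circ'}^2=\inf_{\tilde Q}\operatorname{trace}(B^\top\tilde QB).$$ (The two expressions for $\|\mathcal{S}\|_\varepsilon$ and for $\|\mathcal{S}\|_\omega$ coincide.) *)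

(* Defs.v *)
From mathcomp Require Import all_boot all_order all_algebra.
From mathcomp Require Import complex.
From mathcomp Require Import all_classical all_reals all_analysis.

Set Implicit Arguments.
Unset Strict Implicit.
Unset Printing Implicit Defensive.

Import Order.TTheory GRing.Theory Num.Theory.
Import numFieldNormedType.Exports.

Local Open Scope classical_set_scope.
Local Open Scope ring_scope.

Section LinearAlgebra.
Context {R : realType}.

(* The library norm on matrices is the max norm, hence this definition. *)
Definition enorm (n : nat) (v : 'cV[R]_n) : R :=
  Num.sqrt (\sum_(i < n) v i 0 ^+ 2).

Definition complex_spectrum (n : nat) (A : 'M[R]_n) : set R[i] :=
  [set z | eigenvalue (map_mx (real_complex R) A) z].

Definition stable (n : nat) (A : 'M[R]_n) : Prop :=
  forall z : R[i], complex_spectrum A z -> complex.Re z < 0.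

(* The supremum of a finite set, which is nonempty as soon as [0 < n]. *)
Definition spectral_abscissa (n : nat) (A : 'M[R]_n) : R :=
  sup [set complex.Re z | z in complex_spectrum A].

(* Intended for symmetric [M], whose eigenvalues are all real; then, for
   [0 < n], the supremum is that of a nonempty finite set. *)
Definition lambda_max (n : nat) (M : 'M[R]_n) : R :=
  sup [set a : R | eigenvalue M a].

Definition posdef (n : nat) (M : 'M[R]_n) : Prop :=
  M^T = M /\ forall v : 'cV[R]_n, v != 0 -> 0 < (v^T *m M *m v) 0 0.

Definition possemidef (n : nat) (M : 'M[R]_n) : Prop :=
  M^T = M /\ forall v : 'cV[R]_n, 0 <= (v^T *m M *m v) 0 0.

Definition expmx (n : nat) (A : 'M[R]_n) : 'M[R]_n :=
  \matrix_(i, j)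
    limn (fun N : nat => \sum_(0 <= l < N) (l`!%:R^-1 * (A ^+ l) i j)).

End LinearAlgebra.

Section System.
Context {R : realType}.
Local Notation mu := (@lebesgue_measure R).

(* [||f||_p] on [[0, T]], for [p] in [[1, +oo]]. Extending [|f|] by zero
   outside [[0, T]] changes neither the integral nor the essential supremum,
   as [|f|] is nonnegative. *)
Definition Lnorm_on (n : nat) (T : R) (p : \bar R) (f : R -> 'cV[R]_n) : \bar R :=
  'N[mu]_p[(fun t => (enorm (f t))%:E) \_ `[0, T]].

Definition measurable_on (n : nat) (T : R) (f : R -> 'cV[R]_n) : Prop :=
  forall i : 'I_n, measurable_fun `[0, T] (fun t => f t i 0).

(* Caratheodory solution on [[0, T]] of [x' = A x + B u], [x 0 = x0]:
   [x] is absolutely continuous and satisfies the equation almost everywhere,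
   that is, it is the integral of the integrable function [A x + B u]. *)
Definition trajectory (n m : nat) (A : 'M[R]_n) (B : 'M[R]_(n, m)) (T : R)
    (u : R -> 'cV[R]_m) (x0 : 'cV[R]_n) (x : R -> 'cV[R]_n) : Prop :=
  forall i : 'I_n,
    mu.-integrable `[0, T] (fun s => ((A *m x s + B *m u s) i 0)%:E) /\
    forall t : R, 0 <= t <= T ->
      x t i 0 = x0 i 0 + \int[mu]_(s in `[0, t]) (A *m x s + B *m u s) i 0.

Definition controllable (n m : nat) (A : 'M[R]_n) (B : 'M[R]_(n, m)) : Prop :=
  forall x0 x1 : 'cV[R]_n, exists (T : R) (u : R -> 'cV[R]_m) (x : R -> 'cV[R]_n),
    [/\ 0 < T, measurable_on T u, trajectory A B T u x0 x & x T = x1].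

(* The output on a suitable [[0, T]] determines the initial state. The input is
   taken to be zero: by linearity, its contribution to the output is known. *)
Definition observable (n k : nat) (C : 'M[R]_(k, n)) (A : 'M[R]_n) : Prop :=
  exists2 T : R, 0 < T &
    forall (a b : 'cV[R]_n) (x z : R -> 'cV[R]_n),
      trajectory A (0 : 'M[R]_(n, 0)) T (fun=> 0) a x ->
      trajectory A (0 : 'M[R]_(n, 0)) T (fun=> 0) b z ->
      (forall t : R, 0 <= t <= T -> C *m x t = C *m z t) -> a = b.

Context {n m k : nat}.
Variables (A : 'M[R]_n) (B : 'M[R]_(n, m)) (C : 'M[R]_(k, n)).

(* [y] need only agree with [C x] on [[0, T]]; outside, it is irrelevant. *)
Definition outputs (p : \bar R) (T : R) : set (R -> 'cV[R]_k) :=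
  [set y | exists (u : R -> 'cV[R]_m) (x : R -> 'cV[R]_n),
    [/\ measurable_on T u, (Lnorm_on T p u <= 1)%E, trajectory A B T u 0 x
      & forall t : R, 0 <= t <= T -> y t = C *m x t]].

Definition gain_to_peak (p : \bar R) : \bar R :=
  ereal_sup [set ereal_sup [set Lnorm_on T +oo%E y | y in outputs p T]
            | T in [set T : R | 0 <= T]].

Definition impulse_response (u0 : 'cV[R]_m) (t : R) : 'cV[R]_k :=
  C *m expmx (t *: A) *m B *m u0.

Definition gain_impulse (q : \bar R) : \bar R :=
  ereal_sup [set ereal_sup [set Lnorm_on T q (impulse_response u0)
                           | u0 in [set u0 : 'cV[R]_m | enorm u0 <= 1]]
            | T in [set T : R | 0 <= T]].

Definition alpha_range (a : R) : Prop := 0 < a < - 2 * spectral_abscissa A.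

(* For stable [A] and [a] in [alpha_range] the equation has exactly one solution
   [P], positive definite when [(A, B)] is controllable; dually for [lyapQ]. *)
Definition lyapP (a : R) (P : 'M[R]_n) : Prop :=
  posdef P /\ A *m P + P *m A^T + a *: P + a^-1 *: (B *m B^T) = 0.

Definition lyapQ (a : R) (Q : 'M[R]_n) : Prop :=
  posdef Q /\ Q *m A + A^T *m Q + a *: Q + a^-1 *: (C^T *m C) = 0.

Definition admP (P : 'M[R]_n) : Prop :=
  [/\ posdef P, posdef (- (A *m P + P *m A^T)) & possemidef (P - B *m B^T)].

Definition admQ (Q : 'M[R]_n) : Prop :=
  [/\ posdef Q, posdef (- (Q *m A + A^T *m Q)) & possemidef (Q - C^T *m C)].

(* In the norms indexed by [a], the infimum is the minimum over [a]: it is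
   attained for stable [A], controllable [(A, B)], observable [(C, A)] and
   [0 < n]. *)
Definition norm_star : R := Num.sqrt (inf
  [set c | exists a P, [/\ alpha_range a, lyapP a P
                         & c = lambda_max (C *m P *m C^T)]]).

Definition norm_star' : R := Num.sqrt (inf
  [set c | exists a Q, [/\ alpha_range a, lyapQ a Q
                         & c = lambda_max (B^T *m Q *m B)]]).

(* Equivalently, with [\tr (B^T Q B)] for [lyapQ a Q]. *)
Definition norm_eps : R := Num.sqrt (inf
  [set c | exists a P, [/\ alpha_range a, lyapP a P
                         & c = \tr (C *m P *m C^T)]]).

(* Equivalently, with [lambda_max (B^T Q B)] for [admQ Q]. *)
Definition norm_omega : R := Num.sqrt (inf
  [set lambda_max (C *m P *m C^T) | P in admP]).

Definition norm_circ : R := Num.sqrt (inf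
  [set \tr (C *m P *m C^T) | P in admP]).

Definition norm_circ' : R := Num.sqrt (inf
  [set \tr (B^T *m Q *m B) | Q in admQ]).

End System.

(* Main.v *)
From HB Require Import structures.
Require Import Defs.
From mathcomp Require Import all_boot all_order all_algebra.
From mathcomp Require Import all_classical all_reals all_analysis.
From mathcomp Require Import complex spectral ess_sup_inf measurable_realfun ring lra.

Set Implicit Arguments.
Unset Strict Implicit.
Unset Printing Implicit Defensive.

Import Order.TTheory GRing.Theory Num.Theory.
Import numFieldNormedType.Exports.

Local Open Scope classical_set_scope.
Local Open Scope ring_scope.

(** All the bounds come from quadratic Lyapunov functions. Write [V x] for
    [x^T P^-1 x]; the Cauchy-Schwarz inequality for the form [P] gives
    [|C x|^2 <= lambda_max (C P C^T) * V x] ([output_le_lambda_max]), so that a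
    peak bound amounts to [V <= 1] along the trajectory.

    - Peak to peak: for [P] solution of the first Lyapunov equation,
      [V' <= a * (|u|^2 - V)], hence [V] cannot cross the level [1] if
      [|u| <= 1] ([ellipsoid_invariant]).
    - Integral to peak and impulse to peak: for an admissible [P], the norm
      [sqrt V] satisfies [(sqrt V)' <= |u|] ([sqrt_growth]); an impulse [u0] is
      the initial state [B u0], where [V <= |u0|^2].
    - Impulse to integral: for [Q] solution of the second Lyapunov equation and
      [V x = x^T Q x], the inequality of the means gives [(sqrt V)' <= - |C x|],
      which is integrated from the initial state [B u0] ([output_integral_le]).

    A trajectory is only absolutely continuous. Derivatives along it are avoided:
    the functions used, namely [max (V - 1) 0 ^ 2] and the regularized norm
    [sqrt (V + e^2)], are convex with continuous gradients, and for a convex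
    function of the state the chain rule holds as an inequality between
    increments ([convex_chain_le]), which is the direction needed. Impulse
    responses are brought under the same lemmas by differentiating the series of
    the matrix exponential ([flow_trajectory]).

    Each gain is thus at most the square root of every element of the set whose
    infimum defines the norm, and that set must be shown not to be empty. For
    [a] in the range, a Schur form with small off-diagonal entries gives a
    strict Lyapunov inequality ([lyapunov_inequality]). It makes the Lyapunov
    operator injective on symmetric matrices and its inverse positive
    ([lyapunov_op_solution]). The trajectories from the origin stay orthogonal to
    the kernel of a solution of the first equation, and those that start in the
    kernel of a solution of the second one have a zero output, so that
    controllability and observability make the solutions positive definite
    ([lyapunov_controllable_posdef], [lyapunov_observable_posdef]); scaling
    yields admissible matrices.

    The comparisons of norms rest on [lambda_max <= \tr] for positive
    semidefinite matrices, together with two dualities: the traces of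
    [C P C^T] and [B^T Q B] agree for the same [a] ([trace_lyapP_lyapQ]), and
    [c *: Q^-1] is admissible with [C (c *: Q^-1) C^T <= c] as soon as [Q] is
    admissible and [\tr (B^T Q B) <= c] ([admQ_admP_inverse]). *)

(** * Quadratic forms *)

Section DotProduct.
Context {R : realType}.
Implicit Types (n m : nat).

Definition dot n (u v : 'cV[R]_n) : R := (u^T *m v) 0 0.

Lemma dotE n (u v : 'cV[R]_n) : dot u v = \sum_i u i 0 * v i 0.
Proof. by rewrite /dot mxE; apply: eq_bigr => i _; rewrite mxE. Qed.

Lemma quad_dot n (M : 'M[R]_n) (v : 'cV[R]_n) :
  (v^T *m M *m v) 0 0 = dot v (M *m v).
Proof. by rewrite /dot mulmxA. Qed.

Lemma dotC n (u v : 'cV[R]_n) : dot u v = dot v u.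
Proof. by rewrite !dotE; apply: eq_bigr => i _; rewrite mulrC. Qed.

Lemma dotDr n (u v w : 'cV[R]_n) : dot u (v + w) = dot u v + dot u w.
Proof. by rewrite /dot mulmxDr mxE. Qed.

Lemma dotDl n (u v w : 'cV[R]_n) : dot (u + v) w = dot u w + dot v w.
Proof. by rewrite ![dot _ w]dotC dotDr. Qed.

Lemma dotNr n (u v : 'cV[R]_n) : dot u (- v) = - dot u v.
Proof. by rewrite /dot mulmxN mxE. Qed.

Lemma dotNl n (u v : 'cV[R]_n) : dot (- u) v = - dot u v.
Proof. by rewrite dotC dotNr dotC. Qed.

Lemma dotZr n a (u v : 'cV[R]_n) : dot u (a *: v) = a * dot u v.
Proof. by rewrite /dot -scalemxAr mxE. Qed.

Lemma dotZl n a (u v : 'cV[R]_n) : dot (a *: u) v = a * dot u v.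
Proof. by rewrite dotC dotZr dotC. Qed.

Lemma dot0r n (u : 'cV[R]_n) : dot u 0 = 0.
Proof. by rewrite /dot mulmx0 mxE. Qed.

Lemma dot0l n (u : 'cV[R]_n) : dot 0 u = 0.
Proof. by rewrite dotC dot0r. Qed.

Lemma dot_mulmxl n m (M : 'M[R]_(m, n)) u v : dot (M *m u) v = dot u (M^T *m v).
Proof. by rewrite /dot trmx_mul mulmxA. Qed.

Lemma dot_mulmxr n m (M : 'M[R]_(m, n)) u v : dot u (M *m v) = dot (M^T *m u) v.
Proof. by rewrite dot_mulmxl trmxK. Qed.

Lemma dot_ge0 n (u : 'cV[R]_n) : 0 <= dot u u.
Proof. by rewrite dotE sumr_ge0// => i _; rewrite -expr2 sqr_ge0. Qed.

Lemma dot_eq0 n (u : 'cV[R]_n) : (dot u u == 0) = (u == 0).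
Proof.
apply/eqP/eqP => [|->]; last by rewrite dot0r.
rewrite dotE => /eqP; rewrite psumr_eq0; last by move=> i _; rewrite -expr2 sqr_ge0.
move=> /allP u0; apply/matrixP => i j; rewrite ord1 mxE.
by have := u0 i; rewrite mem_index_enum -expr2 sqrf_eq0 => /(_ isT)/eqP.
Qed.

Lemma dot_gt0 n (u : 'cV[R]_n) : (0 < dot u u) = (u != 0).
Proof. by rewrite lt_neqAle dot_ge0 andbT eq_sym dot_eq0. Qed.

Lemma enorm_ge0 n (u : 'cV[R]_n) : 0 <= enorm u.
Proof. exact: sqrtr_ge0. Qed.

Lemma sqr_enorm n (u : 'cV[R]_n) : enorm u ^+ 2 = dot u u.
Proof.
rewrite sqr_sqrtr ?sumr_ge0//; last by move=> i _; rewrite sqr_ge0.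
by rewrite dotE; apply: eq_bigr => i _; rewrite expr2.
Qed.

Lemma enorm_dot n (u : 'cV[R]_n) : enorm u = Num.sqrt (dot u u).
Proof. by rewrite -sqr_enorm sqrtr_sqr ger0_norm// enorm_ge0. Qed.

Lemma enorm0 n : enorm (0 : 'cV[R]_n) = 0.
Proof. by rewrite enorm_dot dot0r sqrtr0. Qed.

Lemma cauchy_schwarz_psd n (M : 'M[R]_n) (u v : 'cV[R]_n) : possemidef M ->
  dot u (M *m v) ^+ 2 <= dot u (M *m u) * dot v (M *m v).
Proof.
move=> [sM pM].
have q0 (w : 'cV[R]_n) : 0 <= dot w (M *m w) by rewrite -quad_dot.
have sym : dot v (M *m u) = dot u (M *m v) by rewrite dot_mulmxr sM dotC.
set a := dot u (M *m u); set b := dot u (M *m v); set c := dot v (M *m v).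
(* the form at [s *: u + t *: v] *)
have comb (s t : R) : 0 <= s ^+ 2 * a + 2 * s * t * b + t ^+ 2 * c.
  have := q0 (s *: u + t *: v).
  rewrite mulmxDr -!scalemxAr !dotDl !dotDr !dotZl !dotZr sym -/a -/b -/c.
  by lra.
(* [(s, t) = (c, - b)] settles [0 < c] and [(- b, a)] settles [0 < a]; if both
   vanish, then so does [b], by [(1, - b)] *)
have a0 : 0 <= a := q0 u.
have c0 : 0 <= c := q0 v.
have := comb c (- b).
have := comb (- b) a.
have := comb 1 (- b).
move=> h1 h2 h3.
have [cpos|] := ltrP 0 c.
  have : 0 <= c * (a * c - b ^+ 2) by move: h3; lra.
  by rewrite pmulr_rge0// subr_ge0.
move=> cle; have c_eq : c = 0 by lra.
have [apos|ale] := ltrP 0 a.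
  have : 0 <= a * (a * c - b ^+ 2) by move: h2; lra.
  by rewrite pmulr_rge0// subr_ge0.
have a_eq : a = 0 by lra.
by rewrite c_eq a_eq mul0r; move: h1; rewrite a_eq c_eq; lra.
Qed.

Lemma possemidef1 n : possemidef (1%:M : 'M[R]_n).
Proof.
split=> [|v]; first by rewrite trmx1.
by rewrite quad_dot mul1mx dot_ge0.
Qed.

Lemma dot_le_enorm n (u v : 'cV[R]_n) : dot u v <= enorm u * enorm v.
Proof.
have := cauchy_schwarz_psd u v (possemidef1 n).
rewrite !mul1mx -!sqr_enorm -exprMn => h.
have nn : 0 <= enorm u * enorm v by rewrite mulr_ge0// enorm_ge0.
have [d0|d0] := lerP 0 (dot u v); last by rewrite (le_trans (ltW d0)).
by rewrite -(@ler_pXn2r _ 2)// nnegrE.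
Qed.

Lemma posdef_possemidef n (M : 'M[R]_n) : posdef M -> possemidef M.
Proof.
move=> [sM pM]; split=> // v; have [->|v0] := eqVneq v 0.
  by rewrite mulmx0 mxE.
by rewrite ltW// pM.
Qed.

Lemma posdef_dot n (M : 'M[R]_n) v : posdef M -> v != 0 -> 0 < dot v (M *m v).
Proof. by move=> [_ pM] v0; rewrite -quad_dot pM. Qed.

Lemma possemidef_dot n (M : 'M[R]_n) v : possemidef M -> 0 <= dot v (M *m v).
Proof. by move=> [_ pM]; rewrite -quad_dot. Qed.

Lemma posdef_unit n (M : 'M[R]_n) : posdef M -> M \in unitmx.
Proof.
move=> [sM pM]; rewrite unitmxE unitfE; apply/negP => /det0P[v v0 vM].
by have := pM v^T; rewrite trmxK vM mul0mx mxE ltxx trmx_eq0 => /(_ v0).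
Qed.

Lemma sym_kernel n (M : 'M[R]_n) : M^T = M -> M \notin unitmx ->
  exists2 v : 'cV[R]_n, v != 0 & M *m v = 0.
Proof.
move=> sM; rewrite unitmxE unitfE negbK => /det0P[v v0 vM].
exists v^T; first by rewrite trmx_eq0.
by rewrite -[M]trmxK -trmx_mul sM vM trmx0.
Qed.

Lemma quad_le_dot n (M : 'M[R]_n) :
  exists2 K : R, 0 < K & forall v, dot v (M *m v) <= K * dot v v.
Proof.
exists (1 + \sum_i \sum_j `|M i j|) => [|v].
  by rewrite ltr_pwDl// sumr_ge0// => i _; rewrite sumr_ge0.
rewrite mulrDl mul1r (@le_trans _ _ ((\sum_i \sum_j `|M i j|) * dot v v))//; last first.
  by rewrite lerDr dot_ge0.
have le_dot i : v i 0 ^+ 2 <= dot v v.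
  rewrite dotE (bigD1 i)//= -expr2 lerDl sumr_ge0// => j _.
  by rewrite -expr2 sqr_ge0.
rewrite {1}dotE mulr_suml ler_sum// => i _.
rewrite mxE mulr_sumr mulr_suml ler_sum// => j _.
rewrite (le_trans (ler_norm _))// mulrCA normrM ler_wpM2l// normrM.
have := le_dot i; have := le_dot j.
rewrite -(real_normK (num_real (v i 0))) -(real_normK (num_real (v j 0))).
have := sqr_ge0 (`|v i 0| - `|v j 0|); rewrite sqrrB.
by lra.
Qed.

(** A nondegenerate positive semidefinite form controls the Euclidean norm; the
    generalized Cauchy-Schwarz inequality, applied to [v = M (M^-1 v)], replaces
    the usual compactness argument on the unit sphere. *)
Lemma psd_unit_coercive n (M : 'M[R]_n) : possemidef M -> M \in unitmx ->
  exists2 K : R, 0 < K & forall v, dot v v <= K * dot v (M *m v).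
Proof.
move=> pM uM; have [K K0 leK] := quad_le_dot (invmx M); exists K => // v.
have [->|v0] := eqVneq v 0; first by rewrite mulmx0 !dot0l mulr0.
have vv : 0 < dot v v by rewrite dot_gt0.
have := cauchy_schwarz_psd v (invmx M *m v) pM.
rewrite mulKVmx// => h.
have h2 : dot v v ^+ 2 <= dot v (M *m v) * (K * dot v v).
  rewrite (le_trans h)// ler_wpM2l ?possemidef_dot//.
  by rewrite dotC leK.
by rewrite -(ler_pM2r vv) -expr2 (le_trans h2)// mulrA (mulrC K).
Qed.

Lemma quad_le_posdef n (Q M : 'M[R]_n) : posdef Q ->
  exists2 K : R, 0 < K & forall v, dot v (M *m v) <= K * dot v (Q *m v).
Proof.
move=> pQ; have [K K0 leK] := quad_le_dot M.
have [L L0 leL] := psd_unit_coercive (posdef_possemidef pQ) (posdef_unit pQ).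
exists (K * L) => [|v]; first by rewrite mulr_gt0.
by rewrite (le_trans (leK v))// -mulrA ler_pM2l.
Qed.

(** The largest generalized eigenvalue is the supremum of the quotients
    [dot v (M v) / dot v (Q v)]: a nonsingular [l *: Q - M] would be coercive,
    and the supremum could be lowered. *)
Lemma rayleigh_posdef n (Q M : 'M[R]_n) : (0 < n)%N -> posdef Q -> M^T = M ->
  exists l, possemidef (l *: Q - M) /\
    exists2 v : 'cV[R]_n, v != 0 & (l *: Q - M) *m v = 0.
Proof.
move=> n0 pQ sM.
have [K K0 leK] := quad_le_posdef M pQ.
pose S := [set dot v (M *m v) / dot v (Q *m v) | v in [set v : 'cV[R]_n | v != 0]].
have S0 : S !=set0.
  pose v : 'cV[R]_n := const_mx 1.
  have v0 : v != 0.
    by apply/eqP => /matrixP/(_ (Ordinal n0) 0); rewrite !mxE => /eqP; rewrite oner_eq0.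
  by exists (dot v (M *m v) / dot v (Q *m v)); exists v.
have Sub : has_ubound S.
  exists K => _ [v v0 <-]; rewrite ler_pdivrMr ?leK//.
  exact: posdef_dot.
have leS v : dot v (M *m v) <= sup S * dot v (Q *m v).
  have [->|v0] := eqVneq v 0; first by rewrite !dot0l mulr0.
  rewrite -ler_pdivrMr; last exact: posdef_dot.
  by apply: ub_le_sup => //; exists v.
have pS : possemidef (sup S *: Q - M).
  split=> [|v]; first by rewrite linearB linearZ/= sM pQ.1.
  by rewrite quad_dot mulmxBl -scalemxAl dotDr dotNr dotZr subr_ge0.
exists (sup S); split=> //.
apply: sym_kernel; first exact: pS.1.
apply/negP => uS.
have [K1 K10 leK1] := psd_unit_coercive pS uS.
have [K2 K20 leK2] := quad_le_dot Q.
suff : sup S <= sup S - (K1 * K2)^-1.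
  by rewrite lerBrDr gerDl leNgt invr_gt0 mulr_gt0.
apply: ge_sup => // _ [v v0 <-]; have qv := posdef_dot pQ v0.
rewrite ler_pdivrMr// mulrBl lerBrDr -lerBrDl.
rewrite mulrC ler_pdivrMr ?mulr_gt0//.
rewrite (le_trans (leK2 v))// [leRHS](_ : _ = K2 * (K1 *
  (sup S * dot v (Q *m v) - dot v (M *m v)))); last by ring.
rewrite ler_pM2l// (le_trans (leK1 v))// mulmxBl -scalemxAl.
by rewrite dotDr dotNr dotZr.
Qed.

Lemma posdef1 n : posdef (1%:M : 'M[R]_n).
Proof.
split=> [|v v0]; first by rewrite trmx1.
by rewrite quad_dot mul1mx dot_gt0.
Qed.

Lemma eigenvalue_quad n (M : 'M[R]_n) a : M^T = M -> eigenvalue M a ->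
  exists2 v : 'cV[R]_n, v != 0 & dot v (M *m v) = a * dot v v.
Proof.
move=> sM /eigenvalueP[v vM v0]; exists v^T; first by rewrite trmx_eq0.
by rewrite -{1}sM -trmx_mul vM linearZ/= dotZr.
Qed.

(** The set in the definition of [lambda_max] contains the top Rayleigh quotient,
    an upper bound of all eigenvalues; for [n = 0] both sides vanish. *)
Lemma quad_le_lambda_max n (M : 'M[R]_n) v : M^T = M ->
  dot v (M *m v) <= lambda_max M * dot v v.
Proof.
case: n M v => [|n] M v sM; first by rewrite !dotE !big_ord0 mulr0.
have [l [pl [w w0 Mw]]] := rayleigh_posdef (ltn0Sn n) (posdef1 n.+1) sM.
have quad_le u : dot u (M *m u) <= l * dot u u.
  have := possemidef_dot u pl; rewrite mulmxBl -scalemxAl mul1mx.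
  by rewrite dotDr dotNr dotZr subr_ge0.
rewrite (le_trans (quad_le v))// ler_wpM2r ?dot_ge0//.
apply: ub_le_sup.
  exists l => a /(eigenvalue_quad sM)[u u0 Mu].
  by have := quad_le u; rewrite Mu ler_pM2r// dot_gt0.
apply/eigenvalueP; exists w^T; last by rewrite trmx_eq0.
move: Mw; rewrite mulmxBl -scalemxAl mul1mx => /eqP; rewrite subr_eq0 => /eqP lw.
by rewrite -{1}sM -trmx_mul -lw linearZ.
Qed.

Lemma lambda_max_le n (M : 'M[R]_n) c : M^T = M -> 0 <= c ->
  (forall v, dot v (M *m v) <= c * dot v v) -> lambda_max M <= c.
Proof.
move=> sM c0 leM; rewrite /lambda_max.
set S := (X in sup X); have [->|/set0P S0] := eqVneq S set0; first by rewrite sup0.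
apply: ge_sup => // a /(eigenvalue_quad sM)[u u0 Mu].
by have := leM u; rewrite Mu ler_pM2r// dot_gt0.
Qed.

Lemma lambda_max_ge0 n (M : 'M[R]_n) : possemidef M -> 0 <= lambda_max M.
Proof.
case: n M => [|n] M pM.
  rewrite /lambda_max (_ : [set _ | _] = set0) ?sup0//.
  apply/seteqP; split=> // a /(eigenvalue_quad pM.1)[u].
  by rewrite flatmx0 eqxx.
have := quad_le_lambda_max (const_mx 1 : 'cV[R]_n.+1) pM.1.
move=> /(le_trans (possemidef_dot _ pM)); rewrite pmulr_lge0// dot_gt0.
by apply/eqP => /matrixP/(_ 0 0); rewrite !mxE => /eqP; rewrite oner_eq0.
Qed.

Lemma mxtrace_psd_ge0 n (M : 'M[R]_n) : possemidef M -> 0 <= \tr M.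
Proof.
move=> pM; rewrite sumr_ge0// => i _.
have := possemidef_dot (delta_mx i 0) pM.
by rewrite -colE dotC dotE (bigD1 i)//= !mxE !eqxx mulr1 big1 ?addr0// => j /negPf ji;
   rewrite !mxE ji mulr0.
Qed.

(** Cauchy-Schwarz for the form gives [M i j ^ 2 <= M i i * M j j], so that the
    quadratic form is at most the square of [\sum_i sqrt (M i i) * |v i|]. *)
Lemma psd_quad_le_trace n (M : 'M[R]_n) v : possemidef M ->
  dot v (M *m v) <= \tr M * dot v v.
Proof.
move=> pM.
have entry i j : dot (delta_mx i 0) (M *m delta_mx j 0) = M i j.
  rewrite -colE dotC dotE (bigD1 i)//= !mxE !eqxx mulr1 big1 ?addr0// => k /negPf ki.
  by rewrite !mxE ki mulr0.
have Mii i : 0 <= M i i by rewrite -entry possemidef_dot.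
pose a : 'cV[R]_n := \col_i Num.sqrt (M i i).
pose w : 'cV[R]_n := \col_i `|v i 0|.
have Mij i j : `|M i j| <= a i 0 * a j 0.
  rewrite !mxE -sqrtrM// -sqrtr_sqr ler_wsqrtr//.
  by have := cauchy_schwarz_psd (delta_mx i 0) (delta_mx j 0) pM; rewrite !entry.
have aa : dot a a = \tr M.
  by rewrite dotE; apply: eq_bigr => i _; rewrite !mxE -expr2 sqr_sqrtr.
have ww : dot w w = dot v v.
  by rewrite !dotE; apply: eq_bigr => i _; rewrite !mxE -normrM -expr2 ger0_norm ?sqr_ge0.
rewrite -aa -ww (@le_trans _ _ (dot a w ^+ 2))//; last first.
  by have := cauchy_schwarz_psd a w (possemidef1 n); rewrite !mul1mx.
rewrite expr2 [dot a w]dotE mulr_suml dotE ler_sum// => i _.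
rewrite mxE !mulr_sumr ler_sum// => j _.
rewrite (le_trans (ler_norm _))// !normrM.
rewrite [leRHS](_ : _ = `|v i 0| * ((a i 0 * a j 0) * `|v j 0|)).
  by rewrite ler_wpM2l// ler_wpM2r.
by rewrite !mxE; ring.
Qed.

Lemma lambda_max_le_trace n (M : 'M[R]_n) : possemidef M -> lambda_max M <= \tr M.
Proof.
move=> pM; apply: lambda_max_le; [exact: pM.1|exact: mxtrace_psd_ge0|].
by move=> v; exact: psd_quad_le_trace.
Qed.

Lemma possemidef_congr n m (P : 'M[R]_n) (C : 'M[R]_(m, n)) :
  possemidef P -> possemidef (C *m P *m C^T).
Proof.
move=> pP; split=> [|v]; first by rewrite !trmx_mul trmxK pP.1 mulmxA.
by rewrite quad_dot -!mulmxA dot_mulmxr possemidef_dot.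
Qed.

Lemma possemidef_congr_tr n m (Q : 'M[R]_n) (B : 'M[R]_(n, m)) :
  possemidef Q -> possemidef (B^T *m Q *m B).
Proof. by move=> /(possemidef_congr B^T); rewrite trmxK. Qed.

End DotProduct.

(** * Lyapunov equations *)

(** Conjugating a Schur form by the diagonal matrix of the powers of a small [d]
    multiplies its off-diagonal entries by positive powers of [d]. *)
Lemma almost_diagonalization (C : numClosedFieldType) n (A : 'M[C]_n) (e : C) :
  0 < e -> exists W T : 'M[C]_n,
    [/\ W \in unitmx, W *m A = T *m W, forall i j, i != j -> `|T i j| <= e
      & forall i, eigenvalue A (T i i)].
Proof.
move=> e0; have [n0|n0] := posnP n.
  by exists 1%:M, A; rewrite unitmx1 mul1mx mulmx1; split=> //;
    move=> i; exfalso; move: i; rewrite n0 => -[].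
have [P unP trigT] := Schur A n0.
have uP := unitarymx_unit unP.
move: trigT; rewrite /similar_to /= conjumx//; set T0 := _ *m _ => trigT.
have PA : P *m A = T0 *m P by rewrite mulmxKV.
clearbody T0.
pose K : C := \sum_i \sum_j `|T0 i j|.
have K0 : 0 <= K by rewrite sumr_ge0// => i _; rewrite sumr_ge0.
have leK i j : `|T0 i j| <= K.
  rewrite /K (bigD1 i)//= (bigD1 j)//= -addrA lerDl.
  by rewrite addr_ge0 ?sumr_ge0// => k _; rewrite sumr_ge0.
(* small enough for [d * K <= e] and [d <= 1] *)
pose d := e / (K + e).
have Ke : 0 < K + e by rewrite ltr_wpDl.
have d0 : 0 < d by rewrite divr_gt0.
have d1 : d <= 1 by rewrite ler_pdivrMr// mul1r lerDr.
have dK : d * K <= e.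
  by rewrite /d mulrAC ler_pdivrMr// ler_pM2l// lerDl ltW.
pose D : 'M[C]_n := diag_mx (\row_i d ^+ i).
pose E : 'M[C]_n := diag_mx (\row_i d ^- i).
have ED : E *m D = 1%:M.
  rewrite mulmx_diag -diag_const_mx; congr diag_mx; apply/matrixP => i j.
  by rewrite !mxE mulVf// expf_neq0// gt_eqF.
exists (D *m P), (D *m T0 *m E).
have TE i j : (D *m T0 *m E) i j = d ^+ i * T0 i j * d ^- j.
  by rewrite mul_mx_diag mul_diag_mx !mxE.
split.
- by rewrite unitmx_mul uP andbT; have [] := mulmx1_unit ED.
- by rewrite -!mulmxA PA (mulmxA E D) ED mul1mx.
- move=> i j ij; rewrite TE.
  have [lij|lji] := ltnP i j.
    by move/is_trig_mxP: trigT => ->//; rewrite mulr0 mul0r normr0 ltW.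
  have {}lji : (j < i)%N by rewrite ltn_neqAle lji andbT eq_sym.
  rewrite mulrAC -expfB// normrM (le_trans _ dK)//.
  rewrite ler_pM// ger0_norm ?exprn_ge0// ?(ltW d0)//.
  have : (0 < i - j)%N by rewrite subn_gt0.
  by case: (i - j)%N => // k _; rewrite exprS ler_piMr ?(ltW d0)// exprn_ile1// ltW.
- move=> i; rewrite TE mulrAC mulfV ?mul1r ?expf_neq0 ?gt_eqF//.
  have /eigenvalueP[v vT v0] : eigenvalue T0 (T0 i i).
    rewrite eigenvalue_root_char char_poly_trig//.
    rewrite /root horner_prod (bigD1 i)//= hornerXsubC subrr mul0r.
    by rewrite eqxx.
  apply/eigenvalueP; exists (v *m P).
    by rewrite -mulmxA PA mulmxA vT scalemxAl.
  by apply: contra_neq v0 => vP; rewrite -[v](mulmxK uP) vP mul0mx.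
Qed.

Section Lyapunov.
Context {R : realType}.
Implicit Types (n : nat).
Local Notation Re := (@complex.Re R).
Local Notation Im := (@complex.Im R).

Lemma Re_sum I (r : seq I) (P : pred I) (F : I -> R[i]) :
  Re (\sum_(i <- r | P i) F i) = \sum_(i <- r | P i) Re (F i).
Proof. by elim/big_rec2 : _ => // i y1 y2 _ <-; case: (F i); case: y2. Qed.

Lemma Im_sum I (r : seq I) (P : pred I) (F : I -> R[i]) :
  Im (\sum_(i <- r | P i) F i) = \sum_(i <- r | P i) Im (F i).
Proof. by elim/big_rec2 : _ => // i y1 y2 _ <-; case: (F i); case: y2. Qed.

Lemma ReM (x y : R[i]) : Re (x * y) = Re x * Re y - Im x * Im y.
Proof. by case: x => a b; case: y. Qed.

Lemma ImM (x y : R[i]) : Im (x * y) = Re x * Im y + Im x * Re y.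
Proof. by case: x => a b; case: y. Qed.

Lemma le_norm_Re (x : R[i]) (e : R) : `|x| <= e%:C%C -> `|Re x| <= e.
Proof.
rewrite normc_def lecR; apply: le_trans.
by rewrite -sqrtr_sqr ler_wsqrtr// lerDl sqr_ge0.
Qed.

Lemma le_norm_Im (x : R[i]) (e : R) : `|x| <= e%:C%C -> `|Im x| <= e.
Proof.
rewrite normc_def lecR; apply: le_trans.
by rewrite -sqrtr_sqr ler_wsqrtr// lerDr sqr_ge0.
Qed.

(** In coordinates [W v] that nearly diagonalize [A], the derivative of the
    squared modulus of [W v] along [v' = A v] is close to the sum of
    [2 * Re (T i i) * |(W v) i|^2]; the squared modulus, as a real quadratic
    form in the real vector [v], is the Lyapunov function. *)
Lemma lyapunov_inequality n (A : 'M[R]_n) (a b : R) :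
  (forall z, complex_spectrum A z -> Re z <= - b) -> a / 2 < b ->
  exists2 Q : 'M[R]_n, posdef Q &
    forall v, v != 0 -> 2 * dot v (Q *m (A *m v)) + a * dot v (Q *m v) < 0.
Proof.
move=> Ab ab.
(* the off-diagonal terms contribute at most [2 * n * e] times the squared
   modulus, which must stay below the gap [b - a / 2] *)
pose e := (b - a / 2) / (2 * n%:R + 1).
have n1 : 0 < 2 * n%:R + 1 :> R by rewrite ltr_wpDl// mulr_ge0.
have e0 : 0 < e by rewrite divr_gt0// subr_gt0.
have e0c : 0 < e%:C%C by rewrite (_ : 0 = 0%:C%C)// ltcR.
have [W [T [uW WA Toff Tdiag]]] :=
  almost_diagonalization (map_mx (real_complex R) A) e0c.
pose X := map_mx Re W; pose Y := map_mx Im W.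
pose S := map_mx Re T; pose K := map_mx Im T.
have XA : X *m A = S *m X - K *m Y.
  apply/matrixP => i j; have /matrixP/(_ i j) := WA; rewrite !mxE.
  move=> /(congr1 Re); rewrite !Re_sum => WAij.
  transitivity (\sum_k Re (W i k * map_mx (real_complex R) A k j)).
    by apply: eq_bigr => k _; rewrite !mxE ReM/= mulr0 subr0.
  by rewrite WAij -sumrB; apply: eq_bigr => k _; rewrite !mxE ReM.
have YA : Y *m A = S *m Y + K *m X.
  apply/matrixP => i j; have /matrixP/(_ i j) := WA; rewrite !mxE.
  move=> /(congr1 Im); rewrite !Im_sum => WAij.
  transitivity (\sum_k Im (W i k * map_mx (real_complex R) A k j)).
    by apply: eq_bigr => k _; rewrite !mxE ImM/= mulr0 add0r.
  by rewrite WAij -big_split; apply: eq_bigr => k _; rewrite !mxE ImM.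
have qE v w : dot v ((X^T *m X + Y^T *m Y) *m w) =
    dot (X *m v) (X *m w) + dot (Y *m v) (Y *m w).
  by rewrite mulmxDl dotDr -!mulmxA dot_mulmxr trmxK [in X in _ + X]dot_mulmxr trmxK.
have q_gt0 v : v != 0 -> 0 < dot (X *m v) (X *m v) + dot (Y *m v) (Y *m v).
  move=> v0; rewrite lt_neqAle addr_ge0 ?dot_ge0// andbT eq_sym.
  rewrite paddr_eq0 ?dot_ge0// !dot_eq0; apply/negP => /andP[/eqP Xv /eqP Yv].
  have : W *m map_mx (real_complex R) v = 0.
    apply/matrixP => i j; have /matrixP/(_ i j) := Xv; have /matrixP/(_ i j) := Yv.
    rewrite !mxE => Yij Xij; apply/eqP; rewrite eq_complex Re_sum Im_sum/=.
    rewrite -[X in _ == X]Xij -[X in _ && (_ == X)]Yij; apply/andP; split; apply/eqP.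
      by apply: eq_bigr => k _; rewrite !mxE ReM/= mulr0 subr0.
    by apply: eq_bigr => k _; rewrite !mxE ImM/= mulr0 add0r.
  move/(congr1 (mulmx (invmx W))); rewrite mulKmx// mulmx0.
  move=> /matrixP v0'; move/negP: v0; apply; apply/eqP/matrixP => i j.
  by have := v0' i j; rewrite !mxE => /(congr1 Re).
exists (X^T *m X + Y^T *m Y).
  split=> [|v v0]; first by rewrite linearD/= !trmx_mul !trmxK.
  by rewrite quad_dot qE q_gt0.
move=> v v0; rewrite !qE !mulmxA XA YA.
have := q_gt0 v v0; rewrite mulmxBl mulmxDl -!mulmxA.
set p := X *m v; set q := Y *m v => N0; clearbody p q.
pose N i := p i 0 ^+ 2 + q i 0 ^+ 2.
have NE : dot p p + dot q q = \sum_i N i.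
  by rewrite !dotE -big_split; apply: eq_bigr => i _; rewrite /N !expr2.
pose c i j := p i 0 * (S i j * p j 0 - K i j * q j 0) +
              q i 0 * (S i j * q j 0 + K i j * p j 0).
have GE : dot p (S *m p - K *m q) + dot q (S *m q + K *m p) = \sum_i \sum_j c i j.
  rewrite !dotE -big_split; apply: eq_bigr => i _ /=.
  rewrite !mxE -sumrB -big_split !mulr_sumr -big_split.
  by apply: eq_bigr => j _; rewrite /c.
have cle i j : c i j <= e * (N i + N j) + (i == j)%:R * (- b * N i).
  have [<-|ij] := eqVneq i j.
    rewrite mul1r (@le_trans _ _ (- b * N i))//; last first.
      by rewrite lerDr mulr_ge0 ?(ltW e0)// addr_ge0// addr_ge0 ?sqr_ge0.
    rewrite [leLHS](_ : _ = S i i * N i); last by rewrite /c /N; ring.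
    by rewrite ler_wpM2r ?addr_ge0 ?sqr_ge0// !mxE Ab//; exact: Tdiag.
  rewrite mul0r addr0.
  have Sij : `|S i j| <= e by rewrite !mxE le_norm_Re// Toff.
  have Kij : `|K i j| <= e by rewrite !mxE le_norm_Im// Toff.
  have prod_le s t u : `|s| <= e -> s * (t * u) <= e * ((t ^+ 2 + u ^+ 2) / 2).
    move=> se; rewrite (le_trans (ler_norm _))// normrM ler_pM//.
    rewrite normrM -(real_normK (num_real t)) -(real_normK (num_real u)).
    by have := sqr_ge0 (`|t| - `|u|); rewrite sqrrB; lra.
  have NKij : `|- K i j| <= e by rewrite normrN.
  have h1 := prod_le _ (p i 0) (p j 0) Sij.
  have h2 := prod_le _ (p i 0) (q j 0) NKij.
  have h3 := prod_le _ (q i 0) (q j 0) Sij.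
  have h4 := prod_le _ (q i 0) (p j 0) Kij.
  by rewrite /c /N; lra.
have Gle : \sum_i \sum_j c i j <= (2 * n%:R * e - b) * \sum_i N i.
  have -> : (2 * n%:R * e - b) * \sum_i N i =
      \sum_i \sum_j (e * (N i + N j) + (i == j)%:R * (- b * N i)).
    have rowE i : \sum_j (e * (N i + N j) + (i == j)%:R * (- b * N i)) =
        (e * n%:R - b) * N i + e * \sum_j N j.
      rewrite big_split/= -mulr_sumr big_split/= sumr_const card_ord -mulr_natl.
      rewrite [X in _ + X](bigD1 i)//= eqxx mul1r [X in _ + (_ + X)]big1.
        by ring.
      by move=> j /negPf ji; rewrite eq_sym ji mul0r.
    transitivity (\sum_i ((e * n%:R - b) * N i + e * \sum_j N j)).
      rewrite [RHS]big_split/= -mulr_sumr sumr_const card_ord.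
      rewrite -(mulr_natl (e * _) n).
      by ring.
    by apply: eq_bigr => i _; rewrite rowE.
  by rewrite ler_sum// => i _; rewrite ler_sum.
rewrite GE NE; rewrite NE in N0.
have eE : 2 * n%:R * e < b - a / 2.
  rewrite /e mulrA ltr_pdivrMr// mulrC ltr_pM2l ?subr_gt0//.
  by rewrite ltrDl.
apply: (@le_lt_trans _ _ (2 * ((2 * n%:R * e - b) * \sum_i N i) + a * \sum_i N i)).
  by rewrite lerD2r ler_pM2l.
by rewrite mulrA -mulrDl nmulr_rlt0//; lra.
Qed.

Lemma psd_quad0 n (M : 'M[R]_n) v : possemidef M -> dot v (M *m v) = 0 -> M *m v = 0.
Proof.
move=> pM Mv; apply/eqP; rewrite -dot_eq0 -sqrf_eq0 eq_le sqr_ge0 andbT.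
by have := cauchy_schwarz_psd (M *m v) v pM; rewrite Mv mulr0.
Qed.

Lemma psd_antisym n (M : 'M[R]_n) : possemidef M -> possemidef (- M) -> M = 0.
Proof.
move=> pM pNM; apply/matrixP => i j.
suff /psd_quad0 : dot (delta_mx j 0) (M *m delta_mx j 0) = 0.
  by move=> /(_ pM); rewrite -colE => /matrixP/(_ i 0); rewrite !mxE.
apply/eqP; rewrite eq_le possemidef_dot// andbT.
by have := possemidef_dot (delta_mx j 0) pNM; rewrite mulNmx dotNr oppr_ge0.
Qed.

Definition lyapunov_op n (A : 'M[R]_n) (a : R) (X : 'M[R]_n) : 'M[R]_n :=
  X *m A + A^T *m X + a *: X.

(** The derivative of [x^T X x] along [x' = (A + a / 2) x]. *)
Lemma lyapunov_op_quad n (A X : 'M[R]_n) a v : X^T = X ->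
  dot v (lyapunov_op A a X *m v) = 2 * dot v (X *m (A *m v)) + a * dot v (X *m v).
Proof.
move=> sX; rewrite /lyapunov_op !mulmxDl -scalemxAl !dotDr dotZr -!mulmxA.
rewrite [dot v (A^T *m _)]dot_mulmxr trmxK [dot (A *m v) _]dotC.
by rewrite [dot (X *m v) _]dot_mulmxl sX; ring.
Qed.

(** Move from [X] towards the Lyapunov matrix [Q] until the form becomes
    positive semidefinite. If this takes a positive multiple [l] of [Q], then a
    vector in the kernel of [X + l *: Q] contradicts the strict inequality that
    [X + l *: Q] satisfies. *)
Lemma psd_of_lyapunov_inequality n (A Q X : 'M[R]_n) a :
  posdef Q ->
  (forall v, v != 0 -> 2 * dot v (Q *m (A *m v)) + a * dot v (Q *m v) < 0) ->
  X^T = X ->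
  (forall v, 2 * dot v (X *m (A *m v)) + a * dot v (X *m v) <= 0) ->
  possemidef X.
Proof.
move=> pQ ltQ sX leX; split=> // v; rewrite quad_dot.
have [n0|n0] := posnP n; first by
  rewrite dotE big1// => i; have := ltn_ord i; rewrite {2}n0.
have sNX : (- X)^T = - X by rewrite linearN/= sX.
have [l [pl [w w0 lw]]] := rayleigh_posdef n0 pQ sNX.
rewrite opprK in pl lw.
have [l0|l0] := lerP l 0.
  have := possemidef_dot v pl; rewrite mulmxDl -scalemxAl dotDr dotZr.
  have := possemidef_dot v (posdef_possemidef pQ); move=> q0.
  by have := mulr_le0_ge0 l0 q0; lra.
have := ltQ w w0; have := leX w; have := pl.1 => sl.
have e1 : dot w ((l *: Q + X) *m (A *m w)) = 0.
  by rewrite dot_mulmxr sl lw dot0l.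
have e2 : dot w ((l *: Q + X) *m w) = 0 by rewrite lw dot0r.
move: e1 e2; rewrite !mulmxDl -!scalemxAl !dotDr !dotZr => e1 e2 h1 h2.
have : l * (2 * dot w (Q *m (A *m w)) + a * dot w (Q *m w)) < 0.
  by rewrite pmulr_rlt0.
nra.
Qed.

Section Solution.
Variables (n : nat) (A Q : 'M[R]_n) (a : R).
Hypothesis pQ : posdef Q.
Hypothesis ltQ :
  forall v, v != 0 -> 2 * dot v (Q *m (A *m v)) + a * dot v (Q *m v) < 0.

Local Notation L := (lyapunov_op A a).

(** The operator [L] is only known to be injective on symmetric matrices, by
    positivity. On skew-symmetric parts this map is a multiple of the identity,
    so that it is injective on all matrices. *)
Definition lyapunov_ext (X : 'M[R]_n) : 'M[R]_n := L (X + X^T) + (X - X^T).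

Lemma lyapunov_ext_is_linear : linear lyapunov_ext.
Proof.
move=> k X Y; rewrite /lyapunov_ext /lyapunov_op !linearP/=.
rewrite !(mulmxDl, mulmxDr) -!scalemxAr -!scalemxAl.
apply/matrixP => i j; rewrite !mxE; ring.
Qed.

HB.instance Definition _ :=
  GRing.isLinear.Build R 'M[R]_n 'M[R]_n _ lyapunov_ext lyapunov_ext_is_linear.

Lemma lyapunov_ext_sym X S : S^T = S -> lyapunov_ext X = S ->
  X^T = X /\ L (X + X^T) = S.
Proof.
move=> sS XS.
have sL : (L (X + X^T))^T = L (X + X^T).
  have sX : (X + X^T)^T = X + X^T by rewrite linearD/= trmxK addrC.
  move: (X + X^T) sX => Y sY; rewrite /lyapunov_op linearD linearD/= linearZ/=.
  by rewrite !trmx_mul trmxK sY [A^T *m _ + _]addrC.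
have XX : X^T = X.
  have := congr1 trmx XS; rewrite sS -{1}XS /lyapunov_ext linearD/= sL linearB/= trmxK.
  move=> /addrI /matrixP h; apply/matrixP => i j.
  by have := h i j; rewrite !mxE; lra.
by split=> //; rewrite -XS /lyapunov_ext [in X - X^T]XX subrr addr0.
Qed.

Lemma lyapunov_ext_inj X : lyapunov_ext X = 0 -> X = 0.
Proof.
move=> /lyapunov_ext_sym[]; first by rewrite trmx0.
move=> XX; rewrite XX => LX.
have sX2 : (X + X)^T = X + X by rewrite linearD/= XX.
have L0 v : 2 * dot v ((X + X) *m (A *m v)) + a * dot v ((X + X) *m v) = 0.
  by rewrite -lyapunov_op_quad// LX mul0mx dot0r.
have X2 : X + X = 0.
  apply: psd_antisym; apply: (psd_of_lyapunov_inequality pQ ltQ) => //.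
  - by move=> v; rewrite L0.
  - by rewrite linearN/= sX2.
  - by move=> v; rewrite !mulNmx !dotNr !mulrN -opprD L0 oppr0.
by apply/matrixP => i j; have /matrixP/(_ i j) := X2; rewrite !mxE; lra.
Qed.

Lemma lyapunov_ext_surj S : exists X, lyapunov_ext X = S.
Proof.
have uL : lin_mx lyapunov_ext \in unitmx.
  rewrite unitmxE unitfE; apply/negP => /det0P[v v0 vL].
  move/negP: v0; apply; apply/eqP; rewrite -[v]vec_mxK.
  rewrite (@lyapunov_ext_inj (vec_mx v)) ?linear0//.
  by apply: (can_inj mxvecK); rewrite -mul_vec_lin vec_mxK vL linear0.
exists (vec_mx (mxvec S *m invmx (lin_mx lyapunov_ext))).
by apply: (can_inj mxvecK); rewrite -mul_vec_lin vec_mxK mulmxKV.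
Qed.

Lemma lyapunov_op_solution S : possemidef S ->
  exists2 X, possemidef X & L X + S = 0.
Proof.
move=> pS; have [X XS] := lyapunov_ext_surj (- S).
have [||XX LX] := @lyapunov_ext_sym X (- S) => //; first by rewrite linearN/= pS.1.
exists (X + X^T); last by rewrite LX addNr.
have sX : (X + X^T)^T = X + X^T by rewrite XX linearD/= XX.
apply: (psd_of_lyapunov_inequality pQ ltQ) => // v.
by rewrite -lyapunov_op_quad// LX mulNmx dotNr oppr_le0 possemidef_dot.
Qed.

End Solution.

(** * Spectral abscissa *)

Section SpectralAbscissa.
Variables (n : nat) (A : 'M[R]_n).
Hypothesis n0 : (0 < n)%N.

Lemma complex_spectrum_seq : exists2 s : seq R[i], s != [::] &
  forall z, complex_spectrum A z <-> z \in s.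
Proof.
pose p := char_poly (map_mx (real_complex R) A).
have [s ps] := closed_field_poly_normal p.
have monp : p \is monic by exact: char_poly_monic.
rewrite (monicP monp) scale1r in ps.
exists s.
  apply/eqP => s0; have := size_char_poly (map_mx (real_complex R) A).
  by rewrite -/p ps s0 big_nil size_poly1 => -[] n0'; move: n0; rewrite -n0'.
by move=> z; rewrite /complex_spectrum/= eigenvalue_root_char -/p ps root_prod_XsubC.
Qed.

Lemma spectral_abscissa_ge z : complex_spectrum A z -> Re z <= spectral_abscissa A.
Proof.
move=> Az; apply: ub_le_sup; last by exists z.
have [s _ sE] := complex_spectrum_seq.
exists (\big[Num.max/Re z]_(w <- s) Re w) => _ [w /sE ws <-].
by apply: le_bigmax_seq.
Qed.

Lemma spectral_abscissa_lt0 : stable A -> spectral_abscissa A < 0.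
Proof.
move=> stA; have [s s0 sE] := complex_spectrum_seq.
case: s s0 sE => // w s _ sE.
have wA : complex_spectrum A w by apply/sE; rewrite mem_head.
apply: (@le_lt_trans _ _ (\big[Num.max/Re w]_(z <- s) Re z)).
  apply: ge_sup; first by exists (Re w); exists w.
  move=> _ [z /sE + <-]; rewrite inE => /predU1P[->|zs].
    exact: bigmax_ge_id.
  exact: le_bigmax_seq.
rewrite big_seq; apply: bigmax_lt => [|z zs]; first exact: stA.
by apply: stA; apply/sE; rewrite inE zs orbT.
Qed.

End SpectralAbscissa.

End Lyapunov.

(** * Convex functions along absolutely continuous curves *)

Section ChainInequality.
Context {R : realType}.
Local Notation mu := (@lebesgue_measure R).
Implicit Types (T : R) (D : set (measurableTypeR R)).

(** The supremum of the times up to which [f] stays below [f 0] cannot be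
    smaller than [T]. *)
Lemma locally_nonincreasing_le (f : R -> R) T : 0 <= T ->
  (forall c, 0 <= c <= T -> exists2 d, 0 < d & forall s t, 0 <= s <= t -> t <= T ->
     `|s - c| < d -> `|t - c| < d -> f t <= f s) ->
  f T <= f 0.
Proof.
move=> T0 loc.
pose S := [set c | 0 <= c <= T /\ forall e, 0 <= e <= c -> f e <= f 0].
have S0 : S 0.
  split=> [|e]; first by rewrite lexx.
  by rewrite -eq_le => /eqP <-.
have hS : has_sup S by split; [exists 0|exists T => c [/andP[]]].
have s0T : 0 <= sup S <= T.
  by rewrite ub_le_sup ?ge_sup//; [exists 0|move=> c [/andP[]]|exact: hS.2].
have [d d0 locd] := loc _ s0T.
have [c [/andP[c0 cT] fc] sc] := sup_adherent d0 hS.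
have cs : c <= sup S by apply: ub_le_sup; [exact: hS.2|split=> //; rewrite c0].
pose m := Num.min T (sup S + d / 2).
have mT : m <= T by rewrite ge_min lexx.
have md : m <= sup S + d / 2 by rewrite ge_min lexx orbT.
have fe e : 0 <= e <= m -> f e <= f 0.
  move=> /andP[e0 em]; have [ec|/ltW ce] := lerP e c; first by rewrite fc// e0.
  rewrite (@le_trans _ _ (f c))//; last by rewrite fc// c0 lexx.
  apply: locd; first by rewrite c0.
  - exact: le_trans em mT.
  - by rewrite ltr_norml; apply/andP; split; lra.
  - by rewrite ltr_norml; apply/andP; split; lra.
have sm : sup S <= m by rewrite le_min; apply/andP; split; lra.
have Sm : S m by split=> //; rewrite mT andbT; case/andP: s0T => h _; exact: le_trans sm.
have ms : m <= sup S by apply: ub_le_sup => //; exact: hS.2.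
have mE : m = T.
  by rewrite /m; apply: min_idPl; move: ms; rewrite /m ge_min => /orP[]; lra.
by rewrite -{1}mE; apply: fe; rewrite lexx mE T0.
Qed.

Lemma integrable_subitv (f : R -> R) T (s t : R) :
  mu.-integrable `[0, T] (EFin \o f) -> 0 <= s -> t <= T ->
  mu.-integrable `[s, t] (EFin \o f).
Proof.
move=> intf s0 tT; apply: integrableS intf => //.
by apply: subset_itv; rewrite bnd_simp.
Qed.

Lemma Rintegral_itv_sub (f : R -> R) T (s t : R) :
  mu.-integrable `[0, T] (EFin \o f) -> 0 <= s -> s <= t -> t <= T ->
  \int[mu]_(r in `[0, t]) f r - \int[mu]_(r in `[0, s]) f r =
  \int[mu]_(r in `[s, t]) f r.
Proof.
move=> intf s0 st tT.
have i0t := integrable_subitv intf (lexx 0) tT.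
rewrite Rintegral_itvB// ?bnd_simp// Rintegral_itv_obnd_cbnd//.
by apply: integrableS i0t => //; apply: subset_itv; rewrite bnd_simp.
Qed.

Lemma Rintegral_itv_cst (c s t : R) : s <= t ->
  \int[mu]_(r in `[s, t]) c = c * (t - s).
Proof.
move=> st; rewrite Rintegral_cst//; congr (_ * _).
rewrite -[RHS]/(fine (t - s)%:E); congr fine.
apply: etrans; first exact: (lebesgue_measure_itv `[s, t]).
rewrite /= lte_fin; case: ltP => // ts.
by congr EFin; apply/esym/eqP; rewrite subr_eq0 eq_le st ts.
Qed.

Lemma integrable_itv_cst (c s t : R) : mu.-integrable `[s, t] (EFin \o (fun=> c)).
Proof.
apply: continuous_compact_integrable; first exact: segment_compact.
by move=> ?; exact: cvg_cst.
Qed.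

Lemma ae_le_Rintegral D (f g : R -> R) : measurable D ->
  mu.-integrable D (EFin \o f) -> mu.-integrable D (EFin \o g) ->
  {ae mu, forall r, D r -> f r <= g r} ->
  \int[mu]_(r in D) f r <= \int[mu]_(r in D) g r.
Proof.
move=> mD intf intg [N [mN N0 fgN]].
rewrite /Rintegral (negligible_integral mN mD intf N0).
rewrite (negligible_integral mN mD intg N0).
apply: le_Rintegral.
- exact: measurableD.
- by apply: integrableS intf => //; exact: measurableD.
- by apply: integrableS intg => //; exact: measurableD.
- move=> r [Dr Nr]; apply: contrapT => fg; apply: Nr; apply: fgN => /= h.
  by apply: fg; exact: h.
Qed.

Lemma integrable_EFinD D (f g : R -> R) : measurable D ->
  mu.-integrable D (EFin \o f) -> mu.-integrable D (EFin \o g) ->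
  mu.-integrable D (EFin \o (fun r => f r + g r)).
Proof.
move=> mD intf intg; have h := integrableD mD intf intg.
by apply: eq_integrable h.
Qed.

Lemma integrable_EFinM D (k : R) (f : R -> R) : measurable D ->
  mu.-integrable D (EFin \o f) -> mu.-integrable D (EFin \o (fun r => k * f r)).
Proof.
move=> mD intf; have h := integrableZl mD k intf.
by apply: eq_integrable h.
Qed.

Lemma integrable_lin n (a : 'I_n -> R) (f : 'I_n -> R -> R) D :
  measurable D -> (forall i, mu.-integrable D (EFin \o f i)) ->
  mu.-integrable D (EFin \o (fun r => \sum_i a i * f i r)).
Proof.
move=> mD intf.
have h := integrable_sum mD (index_enum 'I_n) (P := xpredT)
  (fun i _ => integrableZl mD (a i) (intf i)).
apply: eq_integrable h => // r _ /=.
by rewrite -sumEFin; apply: eq_bigr.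
Qed.

Lemma Rintegral_lin n (a : 'I_n -> R) (f : 'I_n -> R -> R) D :
  measurable D -> (forall i, mu.-integrable D (EFin \o f i)) ->
  \int[mu]_(r in D) (\sum_i a i * f i r) = \sum_i a i * \int[mu]_(r in D) f i r.
Proof.
move=> mD; elim: n a f => [|n IH] a f intf.
  under eq_Rintegral do rewrite big_ord0.
  by rewrite Rintegral_cst// mul0r big_ord0.
under eq_Rintegral do rewrite big_ord_recl.
rewrite RintegralD//; last 2 first.
- by apply: (integrableZl _ _ (intf ord0)).
- by apply: integrable_lin.
by rewrite RintegralZl// IH// big_ord_recl.
Qed.

(** [trajectory] without the vector field: [x] is the indefinite integral from
    [x0] of [g], which may be any integrable function. *)
Definition primitive_on n T (x0 : 'cV[R]_n) (x g : R -> 'cV[R]_n) :=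
  forall i, mu.-integrable `[0, T] (fun r => (g r i 0)%:E) /\
    forall t, 0 <= t <= T ->
      x t i 0 = x0 i 0 + \int[mu]_(r in `[0, t]) g r i 0.

Lemma primitive_on_continuous n T (x0 : 'cV[R]_n) x g i : 0 <= T ->
  primitive_on T x0 x g -> {within `[0, T], continuous (fun t => x t i 0)}.
Proof.
move=> T0 /(_ i)[intg xE].
apply: (@subspace_eq_continuous _ _ _
  (fun t => x0 i 0 + parameterized_integral mu 0 t (fun r => g r i 0))).
  by move=> t; rewrite inE/= in_itv/= => tT; exact: (esym (xE t tT)).
move=> t; apply: cvgD; first exact: cvg_cst.
exact: (parameterized_integral_continuous T0 intg).
Qed.

(** Any convex function satisfies the chain rule as an inequality: on a short
    interval [[s, t]], its increase is at most [xi (x t)] applied to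
    [x t - x s], the integral of [xi (x t)] applied to [g]; by continuity,
    [xi (x t)] may be replaced with [xi (x r)] up to an error [e * |g r|]. *)
Lemma convex_chain_le n T (x0 : 'cV[R]_n) (x g : R -> 'cV[R]_n)
    (W : 'cV[R]_n -> R) (xi : 'cV[R]_n -> 'cV[R]_n) (rho : R -> R) :
  0 <= T -> primitive_on T x0 x g ->
  (forall y z, W y - W z <= dot (xi y) (y - z)) ->
  (forall i, {within `[0, T], continuous (fun t => xi (x t) i 0)}) ->
  mu.-integrable `[0, T] (EFin \o rho) ->
  {ae mu, forall r, `[0, T]%classic r -> dot (xi (x r)) (g r) <= rho r} ->
  W (x T) <= W (x 0) + \int[mu]_(r in `[0, T]) rho r.
Proof.
move=> T0 xg convW xic intrho lerho.
pose G r := \sum_i `|g r i 0|.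
have intg i : mu.-integrable `[0, T] (EFin \o (fun r => g r i 0)) by have [] := xg i.
have intG : mu.-integrable `[0, T] (EFin \o G).
  rewrite (_ : G = fun r => \sum_i 1 * `|g r i 0|).
    by apply: (@integrable_lin _ (fun=> 1) (fun i r => `|g r i 0|)) => // i;
       exact: integrable_norm.
  by apply/funext => r; apply: eq_bigr => i _; rewrite mul1r.
have G0 : 0 <= \int[mu]_(r in `[0, T]) G r.
  by apply: Rintegral_ge0 => r _; rewrite sumr_ge0.
have step e : 0 < e ->
    W (x T) <= W (x 0) + \int[mu]_(r in `[0, T]) (rho r + e * G r).
  move=> e0.
  have intrhoe : mu.-integrable `[0, T] (EFin \o (fun r => rho r + e * G r)).
    by apply: integrable_EFinD => //; exact: integrable_EFinM.
  pose F t := W (x t) - \int[mu]_(r in `[0, t]) (rho r + e * G r).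
  suff : F T <= F 0.
    by rewrite /F set_itv1 Rintegral_set1 subr0 lerBlDr.
  apply: locally_nonincreasing_le => // c cT.
  have : \forall r \near c, `[0, T]%classic r ->
      forall i, `|xi (x c) i 0 - xi (x r) i 0| < e / 2.
    suff : \forall r \near within `[0, T] (nbhs c),
      forall i, `|xi (x c) i 0 - xi (x r) i 0| < e / 2 by [].
    apply: filter_forall => i.
    have /subspace_continuousP/(_ c) := xic i.
    rewrite /= in_itv/= => /(_ cT)/cvgrPdist_lt/(_ (e / 2)).
    by apply; rewrite divr_gt0.
  move=> /nbhs_ballP[d /= d0 near_c]; exists d => // s t /andP[s0 st] tT sc tc.
  have s0T : `[s, t]%classic `<=` `[0, T]%classic by apply: subset_itv; rewrite bnd_simp.
  have integ_st f : mu.-integrable `[0, T] (EFin \o f) ->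
      mu.-integrable `[s, t] (EFin \o f) by move=> intf; exact: integrable_subitv intf s0 tT.
  suff key : W (x t) - W (x s) <= \int[mu]_(r in `[s, t]) (rho r + e * G r).
    rewrite -subr_ge0 (_ : F s - F t =
      (\int[mu]_(r in `[0, t]) (rho r + e * G r) -
       \int[mu]_(r in `[0, s]) (rho r + e * G r)) - (W (x t) - W (x s))).
      by rewrite (Rintegral_itv_sub intrhoe s0 st tT) subr_ge0.
    by rewrite /F; ring.
  apply: (le_trans (convW _ _)).
  have -> : dot (xi (x t)) (x t - x s) =
      \sum_i xi (x t) i 0 * \int[mu]_(r in `[s, t]) g r i 0.
    rewrite dotE; apply: eq_bigr => i _; congr (_ * _); rewrite !mxE.
    rewrite -(Rintegral_itv_sub (intg i) s0 st tT) !(xg i).2 ?s0 ?(le_trans s0)//.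
      by ring.
    by rewrite (le_trans st).
  rewrite -(@Rintegral_lin _ _ (fun i r => g r i 0))//; last by move=> i; exact: integ_st.
  apply: ae_le_Rintegral => //.
  - by apply: (@integrable_lin _ _ (fun i r => g r i 0)) => // i; exact: integ_st.
  - exact: integ_st.
  apply: (@filterS _ _ (ae_filter_ringOfSetsType mu) _ _ _ lerho) => r {}lerho.
  rewrite /= in_itv/= => /andP[sr rt].
  have r0T : 0 <= r <= T by rewrite (le_trans s0)// (le_trans rt).
  have rc : `|r - c| < d.
    rewrite ltr_norml; apply/andP; split.
      by move: sc; rewrite ltr_norml => /andP[h _]; rewrite (lt_le_trans h)// lerD2r.
    by move: tc; rewrite ltr_norml => /andP[_ h]; rewrite (le_lt_trans _ h)// lerD2r.
  have nr : forall i, `|xi (x c) i 0 - xi (x r) i 0| < e / 2.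
    by apply: near_c; [rewrite /ball/= distrC|rewrite /= in_itv].
  have nt : forall i, `|xi (x c) i 0 - xi (x t) i 0| < e / 2.
    by apply: near_c; [rewrite /ball/= distrC|rewrite /= in_itv/= (le_trans s0)].
  have := lerho; rewrite /= in_itv/= => /(_ r0T) {}lerho.
  apply: (@le_trans _ _ (dot (xi (x r)) (g r) + e * G r)); last by rewrite lerD2r.
  rewrite dotE mulr_sumr -big_split ler_sum//= => i _.
  rewrite -lerBlDl -mulrBl (le_trans (ler_norm _))// normrM ler_wpM2r//.
  rewrite (_ : _ - _ = (xi (x c) i 0 - xi (x r) i 0) - (xi (x c) i 0 - xi (x t) i 0)).
    by rewrite (le_trans (ler_normB _ _))// ltW// [e]splitr ltrD.
  by ring.
apply/ler_addgt0Pl => e e0.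
have k0 : 0 < \int[mu]_(r in `[0, T]) G r + 1 by rewrite ltr_wpDl.
apply: (le_trans (step (e / (\int[mu]_(r in `[0, T]) G r + 1)) _)).
  by rewrite divr_gt0.
rewrite RintegralD//; last exact: integrable_EFinM.
rewrite RintegralZl// [leRHS]addrC addrA lerD2l.
by rewrite mulrAC ler_pdivrMr// ler_pM2l// lerDl ler01.
Qed.
End ChainInequality.

(** * Lyapunov functions along trajectories *)

Section WithinContinuity.
Context {R : realType} {X : topologicalType}.

Lemma continuous_sumr (I : Type) (s : seq I) (f : I -> X -> R) :
  (forall i, continuous (f i)) -> continuous (fun t => \sum_(i <- s) f i t).
Proof.
move=> cf; elim: s => [|i s IH].
  by rewrite (_ : (fun t => _) = fun=> 0) => [t|]; [exact: cvg_cst|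
    apply/funext => t; rewrite big_nil].
rewrite (_ : (fun t => _) = fun t => f i t + \sum_(i <- s) f i t).
  by move=> t; apply: cvgD; [exact: cf|exact: IH].
by apply/funext => t; rewrite big_cons.
Qed.

Lemma continuous_mulr (f g : X -> R) :
  continuous f -> continuous g -> continuous (fun t => f t * g t).
Proof. by move=> cf cg t; apply: cvgM; [exact: cf|exact: cg]. Qed.

Lemma continuous_dot n (f g : X -> 'cV[R]_n) :
  (forall i, continuous (fun t => f t i 0)) ->
  (forall i, continuous (fun t => g t i 0)) ->
  continuous (fun t => dot (f t) (g t)).
Proof.
move=> cf cg; rewrite (_ : (fun t => _) = fun t => \sum_i f t i 0 * g t i 0).
  by apply: continuous_sumr => i; exact: continuous_mulr.
by apply/funext => t; rewrite dotE.
Qed.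

Lemma continuous_mulmx n m (M : 'M[R]_(m, n)) (f : X -> 'cV[R]_n) :
  (forall i, continuous (fun t => f t i 0)) ->
  forall i, continuous (fun t => (M *m f t) i 0).
Proof.
move=> cf i; rewrite (_ : (fun t => _) = fun t => \sum_j M i j * f t j 0).
  by apply: continuous_sumr => j; apply: continuous_mulr => // t; exact: cvg_cst.
by apply/funext => t; rewrite mxE.
Qed.

Lemma continuous_enorm n (f : X -> 'cV[R]_n) :
  (forall i, continuous (fun t => f t i 0)) -> continuous (fun t => enorm (f t)).
Proof.
move=> cf; rewrite (_ : (fun t => _) = fun t => Num.sqrt (dot (f t) (f t))).
  move=> t; apply: (@continuous_comp _ _ _ (fun t => dot (f t) (f t))).
    by apply: continuous_dot.
  exact: sqrt_continuous.
by apply/funext => t; rewrite enorm_dot.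
Qed.

End WithinContinuity.

Section LyapunovFunctions.
Context {R : realType}.
Local Notation mu := (@lebesgue_measure R).
Context {n m : nat} (A : 'M[R]_n) (B : 'M[R]_(n, m)) (H : 'M[R]_n) (T : R).
Hypotheses (pH : possemidef H) (T0 : 0 <= T).
Variables (u : R -> 'cV[R]_m) (x0 : 'cV[R]_n) (x : R -> 'cV[R]_n).
Hypothesis tr : trajectory A B T u x0 x.
Local Notation V y := (dot y (H *m y)).
Local Notation drift r := (dot (H *m x r) (A *m x r + B *m u r)).

Lemma trajectory_continuous i : {within `[0, T], continuous (fun t => x t i 0)}.
Proof. exact: primitive_on_continuous tr. Qed.

Lemma quadratic_chain_le (W : 'cV[R]_n -> R) (c : R -> R) (rho : R -> R) :
  (forall y z, W y - W z <= c (V y) * dot (H *m y) (y - z)) ->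
  (forall v, 0 <= v -> {for v, continuous c}) ->
  mu.-integrable `[0, T] (EFin \o rho) ->
  {ae mu, forall r, `[0, T]%classic r -> c (V (x r)) * drift r <= rho r} ->
  W (x T) <= W (x 0) + \int[mu]_(r in `[0, T]) rho r.
Proof.
move=> convW cc intrho le_rho.
apply: (convex_chain_le (xi := fun y => c (V y) *: (H *m y)) T0 tr) => //.
- by move=> y z; rewrite dotZl.
- move=> i; rewrite (_ : (fun t => _) = fun t => c (V (x t)) * (H *m x t) i 0).
    apply: (@continuous_mulr _ (subspace `[0, T])).
      move=> t; apply: (@continuous_comp (subspace `[0, T]) R R (fun t => V (x t)) c t).
        apply: (@continuous_dot _ (subspace `[0, T])).
          exact: trajectory_continuous.
        apply: (@continuous_mulmx _ (subspace `[0, T])).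
        exact: trajectory_continuous.
      by apply: cc; exact: possemidef_dot.
    apply: (@continuous_mulmx _ (subspace `[0, T])).
    exact: trajectory_continuous.
  by apply/funext => t; rewrite mxE.
- apply: (@filterS _ _ (ae_filter_ringOfSetsType mu) _ _ _ le_rho) => r h Tr.
  by rewrite dotZl h.
Qed.

Lemma quad_tangent (y z : 'cV[R]_n) : V y - V z <= 2 * dot (H *m y) (y - z).
Proof.
have := possemidef_dot (y - z) pH.
rewrite mulmxBr !(dotDl, dotDr, dotNl, dotNr).
rewrite [dot z (H *m y)]dotC [dot y (H *m z)]dot_mulmxr pH.1 [dot y (H *m y)]dotC.
by lra.
Qed.

(** The convex function [(max (V - 1) 0)^2] has a continuous gradient and
    vanishes exactly on the ellipsoid [V <= 1]. Outside of it, [a * (|u|^2 - V)]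
    is nonpositive for [|u| <= 1], so that the function cannot leave [0]. *)
Lemma ellipsoid_invariant (a : R) : 0 <= a ->
  (forall y w, 2 * dot (H *m y) (A *m y + B *m w) <= a * (dot w w - V y)) ->
  {ae mu, forall r, `[0, T]%classic r -> enorm (u r) <= 1} ->
  V (x 0) <= 1 -> V (x T) <= 1.
Proof.
move=> a0 dissip u1 V01.
pose e (v : R) := Num.max (v - 1) 0.
have e_ge0 v : 0 <= e v by rewrite /e le_max lexx orbT.
have eE v : e v = v - 1 /\ 1 <= v \/ e v = 0 /\ v <= 1.
  rewrite /e; have [h|h] := lerP (v - 1) 0; [right|left]; split=> //; lra.
have := @quadratic_chain_le (fun y => e (V y) ^+ 2) (fun v => 4 * e v) (fun=> 0).
have -> : e (V (x 0)) = 0 by case: (eE (V (x 0))) => -[]; lra.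
rewrite expr0n/= add0r Rintegral_cst// mul0r => h.
have : e (V (x T)) ^+ 2 <= 0.
  apply: h.
  - move=> y z; have := quad_tangent y z.
    set d := dot _ (y - z) => hd.
    have : 2 * e (V y) * (V y - V z) <= 4 * e (V y) * d.
      rewrite (_ : 4 * e (V y) * d = 2 * e (V y) * (2 * d)); last by ring.
      by rewrite ler_wpM2l// mulr_ge0.
    apply: le_trans.
    move: (eE (V y)) (eE (V z)); move: (V y) (V z) => p q.
    have pq2 := sqr_ge0 (p - q); have p2 := sqr_ge0 (p - 1).
    have q2 := sqr_ge0 (q - 1).
    move=> -[[-> p1]|[-> p1]] [[-> q1]|[-> q1]]; [lra| |lra|lra].
    have : 0 <= (p - 1) * (1 - q) by rewrite mulr_ge0// subr_ge0.
    by lra.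
  - move=> v _; apply: cvgM; first exact: cvg_cst.
    have c1 : {for v, continuous (fun w : R => w - 1)}.
      by apply: cvgB; [exact: cvg_id|exact: cvg_cst].
    exact: (continuous_max c1 (cvg_cst 0)).
  - rewrite (_ : EFin \o _ = cst 0%E)//; exact: integrable0.
  - apply: (@filterS _ _ (ae_filter_ringOfSetsType mu) _ _ _ u1) => r {}u1 Tr.
    have := dissip (x r) (u r); rewrite -sqr_enorm => hd.
    have u2 : enorm (u r) ^+ 2 <= 1 by rewrite expr_le1 ?enorm_ge0// u1.
    have hd2 : 2 * drift r <= a * (1 - V (x r)).
      by rewrite (le_trans hd)// ler_wpM2l// lerD2r.
    case: (eE (V (x r))) => -[-> Vr]; last by rewrite mulr0 mul0r.
    have : (V (x r) - 1) * (2 * drift r) <= (V (x r) - 1) * (a * (1 - V (x r))).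
      by rewrite ler_wpM2l// subr_ge0.
    have : 0 <= a * (V (x r) - 1) ^+ 2 by rewrite mulr_ge0// sqr_ge0.
    by move: (drift r) => d; nra.
case: (eE (V (x T))) => -[-> //] VT; rewrite real_exprn_even_le0 ?num_real//.
by rewrite subr_eq0 => /eqP ->.
Qed.

(** [sqrt (V + e^2)] is a convex approximation of the norm [sqrt V] with a
    gradient that is continuous at the origin too. *)
Lemma sqrt_chain_le (e : R) (rho : R -> R) : 0 < e ->
  mu.-integrable `[0, T] (EFin \o rho) ->
  {ae mu, forall r, `[0, T]%classic r ->
    drift r <= Num.sqrt (V (x r) + e ^+ 2) * rho r} ->
  Num.sqrt (V (x T) + e ^+ 2) <=
    Num.sqrt (V (x 0) + e ^+ 2) + \int[mu]_(r in `[0, T]) rho r.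
Proof.
move=> e0 intrho le_rho.
have V0 y : 0 <= V y by exact: possemidef_dot.
have Ve v : 0 <= v -> 0 < v + e ^+ 2 by move=> v0; rewrite ltr_wpDl// exprn_gt0.
apply: (@quadratic_chain_le (fun y => Num.sqrt (V y + e ^+ 2))
  (fun v => (Num.sqrt (v + e ^+ 2))^-1)) => //.
- move=> y z; have sy : 0 < Num.sqrt (V y + e ^+ 2) by rewrite sqrtr_gt0 Ve.
  rewrite mulrC ler_pdivlMr// mulrBl -expr2 sqr_sqrtr ?(ltW (Ve _ (V0 _)))//.
  suff : dot (H *m y) z + e ^+ 2 <=
      Num.sqrt (V z + e ^+ 2) * Num.sqrt (V y + e ^+ 2).
    by rewrite dotDr dotNr [dot (H *m y) y]dotC; lra.
  rewrite -sqrtrM ?(ltW (Ve _ (V0 _)))// (le_trans (ler_norm _))// -sqrtr_sqr ler_wsqrtr//.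
  have := cauchy_schwarz_psd y z pH.
  have := quad_tangent y z; have := possemidef_dot (y - z) pH.
  rewrite mulmxBr !(dotDl, dotDr, dotNl, dotNr).
  rewrite [dot z (H *m y)]dotC [dot y (H *m z)]dot_mulmxr pH.1.
  have := sqr_ge0 e; have := V0 y; have := V0 z.
  move: (V y) (V z) (dot (H *m y) z) => a b c b0 a0 ee h1 h2 h3.
  have : 0 <= e ^+ 2 * (a + b - 2 * c) by rewrite mulr_ge0//; lra.
  by nra.
- move=> v v0; apply: cvgV; first by rewrite gt_eqF// sqrtr_gt0 Ve.
  apply: (@continuous_comp _ _ _ (fun v => v + e ^+ 2)).
    by apply: cvgD; [exact: cvg_id|exact: cvg_cst].
  exact: sqrt_continuous.
- apply: (@filterS _ _ (ae_filter_ringOfSetsType mu) _ _ _ le_rho) => r h Tr.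
  by rewrite ler_pdivrMl ?sqrtr_gt0 ?Ve// h.
Qed.

Lemma sqrt_le_add (v e : R) : 0 <= v -> 0 <= e ->
  Num.sqrt v <= Num.sqrt (v + e ^+ 2) <= Num.sqrt v + e.
Proof.
move=> v0 e0; rewrite ler_wsqrtr ?lerDl ?sqr_ge0//=.
rewrite -[leRHS]ger0_norm ?addr_ge0 ?sqrtr_ge0// -sqrtr_sqr ler_wsqrtr//.
by rewrite sqrrD sqr_sqrtr// -addrA lerD2l lerDr mulrn_wge0// mulr_ge0// sqrtr_ge0.
Qed.

(** The norm [sqrt V] grows at most at the rate [|u|]. The constant [1] in front
    of the integral is what a bound on the derivative of [V] itself, by
    [2 * sqrt V * |u|], would not give directly. *)
Lemma sqrt_growth :
  (forall y w, dot (H *m y) (A *m y + B *m w) <= Num.sqrt (V y) * enorm w) ->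
  mu.-integrable `[0, T] (EFin \o (fun r => enorm (u r))) ->
  Num.sqrt (V (x T)) <=
    Num.sqrt (V (x 0)) + \int[mu]_(r in `[0, T]) enorm (u r).
Proof.
move=> dissip intu; apply/ler_addgt0Pl => e e0.
have V0 y : 0 <= V y by exact: possemidef_dot.
have /andP[h1 _] := sqrt_le_add (V0 (x T)) (ltW e0).
have /andP[_ h2] := sqrt_le_add (V0 (x 0)) (ltW e0).
apply: (le_trans h1).
rewrite addrA [e + _]addrC (le_trans _ (lerD h2 (lexx _)))//.
apply: sqrt_chain_le => //; apply: aeW => r _.
rewrite (le_trans (dissip _ _))// ler_wpM2r ?enorm_ge0//.
by have /andP[] := sqrt_le_add (V0 (x r)) (ltW e0).
Qed.

(** The inequality of the means bounds the output [z = C x] by the dissipation: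
    [2 * sqrt (V + e^2) * |z| <= a * (V + e^2) + |z|^2 / a]. Hence
    [sqrt (V + e^2)] decreases at the rate [|z|], up to [a * e / 2]. *)
Lemma output_integral_le (k : nat) (C : 'M[R]_(k, n)) (a : R) : 0 < a ->
  (forall r, 2 * drift r <= - (a * V (x r) + a^-1 * dot (C *m x r) (C *m x r))) ->
  \int[mu]_(r in `[0, T]) enorm (C *m x r) <= Num.sqrt (V (x 0)).
Proof.
move=> a0 dissip.
have V0 y : 0 <= V y by exact: possemidef_dot.
have cz : {within `[0, T], continuous (fun r => enorm (C *m x r))}.
  apply: (@continuous_enorm _ (subspace `[0, T])).
  apply: (@continuous_mulmx _ (subspace `[0, T])).
  exact: trajectory_continuous.
have intz : mu.-integrable `[0, T] (EFin \o (fun r => enorm (C *m x r))).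
  by apply: continuous_compact_integrable => //; exact: segment_compact.
have intc (b : R) : mu.-integrable `[0, T] (EFin \o (fun=> b)).
  exact: integrable_itv_cst.
suff step e : 0 < e -> \int[mu]_(r in `[0, T]) enorm (C *m x r) <=
    Num.sqrt (V (x 0)) + e * (1 + a / 2 * T).
  have k0 : 0 < 1 + a / 2 * T by rewrite ltr_wpDr// mulr_ge0// divr_ge0// ltW.
  apply/ler_addgt0Pl => e e0.
  by have := step (e / (1 + a / 2 * T)) (divr_gt0 e0 k0); rewrite divfK ?gt_eqF// addrC.
move=> e0.
have /andP[_ h2] := sqrt_le_add (V0 (x 0)) (ltW e0).
(* the rate bound [a * e / 2 - |z|] tends to [- |z|] as [e] tends to [0] *)
have int2 : mu.-integrable `[0, T] (EFin \o (fun r => a * e / 2 + (-1) * enorm (C *m x r))).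
  by apply: integrable_EFinD => //; exact: integrable_EFinM.
have := @sqrt_chain_le e _ e0 int2.
rewrite RintegralD//; last exact: integrable_EFinM.
rewrite Rintegral_itv_cst// subr0 RintegralZl//.
move=> h.
have : 0 <= Num.sqrt (V (x T) + e ^+ 2) by exact: sqrtr_ge0.
suff hyp : {ae mu, forall r, `[0, T]%classic r -> drift r <=
    Num.sqrt (V (x r) + e ^+ 2) * (a * e / 2 + -1 * enorm (C *m x r))}.
  by have := h hyp; lra.
apply: aeW => r _.
have := dissip r; rewrite -sqr_enorm.
have : e <= Num.sqrt (V (x r) + e ^+ 2).
  by rewrite -{1}(ger0_norm (ltW e0)) -sqrtr_sqr ler_wsqrtr// lerDr.
have : Num.sqrt (V (x r) + e ^+ 2) ^+ 2 = V (x r) + e ^+ 2.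
  by rewrite sqr_sqrtr// addr_ge0// sqr_ge0.
move: (V (x r)) (drift r) (enorm (C *m x r)) (Num.sqrt (V (x r) + e ^+ 2)).
move=> v d z s sE es dle.
have : 0 <= a^-1 * (a * s - z) ^+ 2 by rewrite mulr_ge0 ?sqr_ge0// invr_ge0 ltW.
rewrite (_ : a^-1 * _ = a * s ^+ 2 - 2 * s * z + a^-1 * z ^+ 2); last first.
  by field; rewrite gt_eqF.
rewrite sE => h3.
have : e * (e * a) <= s * (e * a) by rewrite ler_wpM2r// mulr_ge0 ?ltW.
by lra.
Qed.

End LyapunovFunctions.

(** * The matrix exponential as a trajectory *)

Section MatrixExponential.
Context {R : realType}.
Local Notation mu := (@lebesgue_measure R).
Context {n : nat} (A : 'M[R]_n).

Let M := 1 + \sum_i \sum_j `|A i j|.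

Let M_ge0 : 0 <= M.
Proof. by rewrite addr_ge0// sumr_ge0// => i _; rewrite sumr_ge0. Qed.

Lemma norm_exprmx_le l i j : `|(A ^+ l) i j| <= M ^+ l.
Proof.
elim: l i j => [|l IH] i j.
  by rewrite expr0 mxE expr0; case: (i == j); rewrite ?normr1// normr0.
rewrite exprS mxE (le_trans (ler_norm_sum _ _ _))//.
apply: (@le_trans _ _ (\sum_k `|A i k| * M ^+ l)).
  by apply: ler_sum => k _; rewrite normrM ler_wpM2l.
rewrite -mulr_suml exprS ler_wpM2r ?exprn_ge0//.
rewrite /M [X in _ <= _ + X](bigD1 i)//= addrCA lerDl addr_ge0// sumr_ge0// => k _.
by rewrite sumr_ge0.
Qed.

Let c i j l := l`!%:R^-1 * (A ^+ l) i j.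

Lemma is_cvg_expmx t i j : cvgn (pseries (c i j) t).
Proof.
apply: normed_cvg; apply: (@series_le_cvg _ _ (exp_coeff (M * `|t|))) => //.
- by move=> l; exact: normr_ge0.
- by move=> l; apply: exp_coeff_ge0; rewrite mulr_ge0.
- move=> l; rewrite /exp_coeff/= /c !normrM normrX exprMn normfV normr_nat.
  rewrite -mulrA mulrC [leLHS]mulrC [leRHS]mulrC ler_wpM2l ?invr_ge0//.
  by rewrite ler_wpM2r ?exprn_ge0// norm_exprmx_le.
- exact: is_cvg_series_exp_coeff.
Qed.

Lemma exprmxZ (t : R) l : (t *: A) ^+ l = t ^+ l *: A ^+ l.
Proof.
elim: l => [|l IH]; first by rewrite !expr0 scale1r.
rewrite !exprS IH -[LHS]/((t *: A) *m (t ^+ l *: A ^+ l)).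
by rewrite -scalemxAl -scalemxAr scalerA.
Qed.

Lemma expmx_pseries t i j : expmx (t *: A) i j = limn (pseries (c i j) t).
Proof.
rewrite mxE; congr (limn _); apply/funext => N.
rewrite /pseries/series/=; apply: eq_bigr => l _.
by rewrite exprmxZ mxE /c; ring.
Qed.

Definition flow (v : 'cV[R]_n) (t : R) : 'cV[R]_n := expmx (t *: A) *m v.

Definition flow_coeff (v : 'cV[R]_n) i l := l`!%:R^-1 * (A ^+ l *m v) i 0.

Lemma cvg_sumr (I : Type) (s : seq I) (f : I -> nat -> R) (a : I -> R) :
  (forall i, f i @ \oo --> a i) ->
  (fun N => \sum_(i <- s) f i N) @ \oo --> \sum_(i <- s) a i.
Proof.
move=> fa; elim: s => [|i s IH].
  rewrite big_nil (_ : (fun N => _) = fun=> 0); first exact: cvg_cst.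
  by apply/funext => N; rewrite big_nil.
rewrite big_cons (_ : (fun N => _) = fun N => f i N + \sum_(i <- s) f i N).
  by apply: cvgD; [exact: fa|exact: IH].
by apply/funext => N; rewrite big_cons.
Qed.

Lemma flow_cvg v i t : pseries (flow_coeff v i) t @ \oo --> flow v t i 0.
Proof.
rewrite /flow mxE.
rewrite (_ : pseries _ t = fun N => \sum_j pseries (c i j) t N * v j 0).
  apply: cvg_sumr => j; apply: cvgM; last exact: cvg_cst.
  by rewrite expmx_pseries; exact: is_cvg_expmx.
apply/funext => N; rewrite /pseries/series/=.
under [RHS]eq_bigr do rewrite mulr_suml.
rewrite exchange_big/=; apply: eq_bigr => l _.
rewrite /flow_coeff mxE mulr_sumr mulr_suml; apply: eq_bigr => j _.
by rewrite /c; ring.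
Qed.

(** Differentiating the power series of the flow term by term replaces [v] with
    [A v]. *)
Lemma pseries_diffs_flow v i :
  pseries_diffs (flow_coeff v i) = flow_coeff (A *m v) i.
Proof.
apply/funext => l; rewrite /pseries_diffs /flow_coeff exprSr -mulmxA factS natrM.
by rewrite invfM mulrA mulrA mulfV ?mul1r// pnatr_eq0.
Qed.

Lemma flow_commute v t : A *m flow v t = flow (A *m v) t.
Proof.
apply/matrixP => i j; rewrite ord1.
apply: (@cvg_unique _ (@norm_hausdorff R R^o) (pseries (flow_coeff (A *m v) i) t @ \oo)) => //;
  last exact: flow_cvg.
rewrite mxE (_ : pseries _ t = fun N => \sum_k A i k * pseries (flow_coeff v k) t N).
  by apply: cvg_sumr => k; apply: cvgM; [exact: cvg_cst|exact: flow_cvg].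
apply/funext => N; rewrite /pseries/series/=.
under [RHS]eq_bigr do rewrite mulr_sumr.
rewrite exchange_big/=; apply: eq_bigr => l _.
have AlA : A ^+ l *m A = A *m A ^+ l.
  by rewrite -[LHS]/(A ^+ l * A) -exprSr exprS.
rewrite /flow_coeff mulmxA AlA -mulmxA mxE mulr_sumr mulr_suml.
by apply: eq_bigr => k _; ring.
Qed.

Lemma is_derive_flow v i t :
  is_derive t (1 : R) (fun s => flow v s i 0) ((A *m flow v t) i 0).
Proof.
have fE w s : flow w s i 0 = limn (pseries (flow_coeff w i) s).
  by apply/esym/cvg_lim => //; exact: flow_cvg.
have cvgf w s : cvgn (pseries (flow_coeff w i) s).
  by apply/cvg_ex; exists (flow w s i 0); exact: flow_cvg.
rewrite flow_commute fE -pseries_diffs_flow.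
rewrite (_ : (fun s => _) = fun s => limn (pseries (flow_coeff v i) s)).
  apply: (@pseries_snd_diffs _ _ (`|t| + 1)); rewrite ?pseries_diffs_flow//.
  by rewrite [ltRHS]ger0_norm ?ltrDl ?addr_ge0.
by apply/funext => s.
Qed.

Lemma flow0 v : flow v 0 = v.
Proof.
apply/matrixP => i j; rewrite ord1.
apply: (@cvg_unique _ (@norm_hausdorff R R^o) (pseries (flow_coeff v i) 0 @ \oo)) => //;
  first exact: flow_cvg.
rewrite /= -cvg_shiftS (_ : (fun N => _) = fun=> v i 0); first exact: cvg_cst.
apply/funext => N; rewrite /pseries/series/= big_nat_recl// big1 => [|l _].
  by rewrite /flow_coeff !expr0 fact0 invr1 mul1mx mul1r mulr1 addr0.
by rewrite expr0n mulr0.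
Qed.

Lemma continuous_flow v i : continuous (fun s => flow v s i 0).
Proof.
move=> t; apply/differentiable_continuous/derivable1_diffP.
by have [] := is_derive_flow v i t.
Qed.

Lemma flow_trajectory m (B : 'M[R]_(n, m)) v T : 0 <= T ->
  trajectory A B T (fun=> 0) v (flow v).
Proof.
move=> T0 i.
have fE : (fun s => (A *m flow v s + B *m 0) i 0) = fun s => flow (A *m v) s i 0.
  by apply/funext => s; rewrite mulmx0 addr0 flow_commute.
have cf a b : {within `[a, b], continuous (fun s => flow (A *m v) s i 0)}.
  by apply: continuous_subspaceT; exact: continuous_flow.
split.
  rewrite (_ : (fun s => _) = EFin \o (fun s => flow (A *m v) s i 0)).
    by apply: continuous_compact_integrable => //; exact: segment_compact.
  by apply/funext => s /=; rewrite mulmx0 addr0 flow_commute.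
move=> t /andP[t0 tT]; under eq_Rintegral do rewrite mulmx0 addr0 flow_commute.
have [<-|t0'] := eqVneq 0 t.
  by rewrite set_itv1 Rintegral_set1 addr0 flow0.
have {}t0 : 0 < t by rewrite lt_neqAle t0'.
rewrite /Rintegral (@continuous_FTC2 _ _ (fun s => flow v s i 0))//=.
- by rewrite flow0 addrCA subrr addr0.
- split.
  + by move=> s _; have [] := is_derive_flow v i s.
  + by apply: cvg_at_right_filter; exact: continuous_flow.
  + by apply: cvg_at_left_filter; exact: continuous_flow.
- by move=> s _; rewrite derive1E (@derive_val _ _ _ _ _ _ _ (is_derive_flow v i s)) flow_commute.
Qed.

End MatrixExponential.

(** * Reachable and unobservable subspaces *)

Section Reachability.
Context {R : realType}.
Local Notation mu := (@lebesgue_measure R).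

(** Over a time shorter than [1 / (2 K)], the integral of [f] at most doubles;
    hence the set of times at which it vanishes is open to the right. *)
Lemma gronwall_homogeneous (f : R -> R) (K T : R) : 0 <= T -> 0 < K ->
  mu.-integrable `[0, T] (EFin \o f) ->
  (forall t, 0 <= t <= T -> 0 <= f t) ->
  (forall t, 0 <= t <= T -> f t <= K * \int[mu]_(r in `[0, t]) f r) ->
  f T <= 0.
Proof.
move=> T0 K0 intf f0 fle.
pose G t := \int[mu]_(r in `[0, t]) f r.
have GB s t : 0 <= s -> s <= t -> t <= T -> G t - G s = \int[mu]_(r in `[s, t]) f r.
  by move=> *; exact: Rintegral_itv_sub intf _ _ _.
have Gmono s t : 0 <= s -> s <= t -> t <= T -> G s <= G t.
  move=> s0 st tT; rewrite -subr_ge0 GB//; apply: Rintegral_ge0 => r.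
  rewrite /= in_itv/= => /andP[sr rt].
  by rewrite f0// (le_trans s0 sr) (le_trans rt tT).
have grow s t : 0 <= s -> s <= t -> t <= T -> G t - G s <= K * G t * (t - s).
  move=> s0 st tT; rewrite GB//.
  have : \int[mu]_(r in `[s, t]) f r <= \int[mu]_(r in `[s, t]) (K * G t).
    apply: le_Rintegral => //.
    - exact: integrable_subitv intf s0 tT.
    - exact: integrable_itv_cst.
    - move=> r; rewrite /= in_itv/= => /andP[sr rt].
      have r0T : 0 <= r <= T by rewrite (le_trans s0 sr) (le_trans rt tT).
      by rewrite (le_trans (fle r r0T))// ler_pM2l// Gmono//; case/andP: r0T.
  move=> /le_trans; apply.
  by rewrite Rintegral_itv_cst.
suff G0 : G T <= 0.
  by rewrite (le_trans (fle T _)) ?T0 ?lexx// pmulr_rle0.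
(* vanishing of [G] propagates along short intervals: the indicator function
   of [0 < G] is locally nonincreasing *)
pose phi t : R := (0 < G t)%R%:R.
suff : phi T <= phi 0.
  rewrite /phi {2}/G set_itv1 Rintegral_set1 ltxx.
  by case: ltP => // _; rewrite ler10.
apply: locally_nonincreasing_le => // c _.
exists (K * 4)^-1 => [|s t /andP[s0 st] tT sc tc]; first by rewrite invr_gt0 mulr_gt0.
rewrite /phi ler_nat; case: ltP => // Gt; case: ltP => // Gs.
have := grow s t s0 st tT.
have : K * (t - s) <= 2^-1.
  have ts : t - s <= (K * 4)^-1 + (K * 4)^-1.
    move: sc tc; rewrite !ltr_norml => /andP[h1 _] /andP[_ h2].
    by have := lerD (ltW h1) (ltW h2); lra.
  have := ler_wpM2l (ltW K0) ts.
  have -> : K * ((K * 4)^-1 + (K * 4)^-1) = 2^-1 by field; rewrite gt_eqF.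
  by [].
move: (G t) (G s) Gt Gs => p q p0 q0 h1 h2.
have : p * (K * (t - s)) <= p * 2^-1 by rewrite ler_wpM2l// ltW.
by lra.
Qed.

(** The sum of the [|w i|] satisfies the hypothesis of [gronwall_homogeneous]. *)
Lemma homogeneous_primitive_eq0 n (M : 'M[R]_n) (w : R -> 'cV[R]_n) T : 0 <= T ->
  primitive_on T 0 w (fun r => M *m w r) -> w T = 0.
Proof.
move=> T0 prim.
pose f t := \sum_j `|w t j 0|.
pose K0 := \sum_i \sum_j `|M i j|.
have K00 : 0 <= K0 by rewrite sumr_ge0// => i _; rewrite sumr_ge0.
have intw j : mu.-integrable `[0, T] (EFin \o (fun r => w r j 0)).
  apply: continuous_compact_integrable; first exact: segment_compact.
  exact: primitive_on_continuous prim.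
have intf : mu.-integrable `[0, T] (EFin \o f).
  rewrite (_ : f = fun r => \sum_j 1 * `|w r j 0|).
    by apply: (@integrable_lin _ _ (fun=> 1) (fun j r => `|w r j 0|)) => // j;
       exact: integrable_norm.
  by apply/funext => r; apply: eq_bigr => j _; rewrite mul1r.
have f0 t : 0 <= f t by rewrite sumr_ge0.
have fle t : 0 <= t <= T -> f t <= (n%:R * K0 + 1) * \int[mu]_(r in `[0, t]) f r.
  move=> /andP[t0 tT]; have int_t := integrable_subitv intf (lexx 0) tT.
  have If0 : 0 <= \int[mu]_(r in `[0, t]) f r by apply: Rintegral_ge0.
  have wle i : `|w t i 0| <= K0 * \int[mu]_(r in `[0, t]) f r.
    have [intM ->] := prim i; last by rewrite t0.
    have intMt := integrable_subitv intM (lexx 0) tT.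
    rewrite mxE add0r (le_trans (le_normr_Rintegral _ intMt))//.
    rewrite -RintegralZl//; apply: le_Rintegral => //.
    - exact: integrable_norm.
    - exact: integrable_EFinM.
    - move=> r _; rewrite mxE (le_trans (ler_norm_sum _ _ _))// mulr_sumr ler_sum// => j _.
      rewrite normrM ler_wpM2r// /K0 (bigD1 i)//= (bigD1 j)//= -addrA lerDl.
      by rewrite addr_ge0 ?sumr_ge0// => k _; rewrite sumr_ge0.
  rewrite mulrDl mul1r -mulrA (@le_trans _ _ (n%:R * (K0 * \int[mu]_(r in `[0, t]) f r)))//.
    by rewrite -[X in X%:R * _]card_ord mulr_natl -sumr_const ler_sum.
  by rewrite lerDl.
have kpos : 0 < n%:R * K0 + 1 by rewrite ltr_wpDl// mulr_ge0.
have fT : f T = 0.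
  apply/eqP; rewrite eq_le f0 andbT.
  exact: (gronwall_homogeneous T0 kpos intf (fun t _ => f0 t) fle).
apply/matrixP => i j; rewrite ord1 mxE; apply/eqP; rewrite -normr_le0 -fT.
by rewrite /f (bigD1 i)//= lerDl sumr_ge0.
Qed.

(** Along a trajectory from the origin, [N x] solves the homogeneous equation
    [w' = M w] with [w 0 = 0], hence vanishes; but [x] reaches every state. *)
Lemma controllable_invariant_eq0 n m (A : 'M[R]_n) (B : 'M[R]_(n, m)) (N M : 'M[R]_n) :
  controllable A B -> N *m A = M *m N -> N *m B = 0 -> N = 0.
Proof.
move=> ctrl NA NB.
have N0 (x1 : 'cV[R]_n) : N *m x1 = 0.
  have [T [u [x [T0 _ tr <-]]]] := ctrl 0 x1.
  apply: (@homogeneous_primitive_eq0 _ M (fun t => N *m x t) T (ltW T0)) => i.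
  have dE r : (M *m (N *m x r)) i 0 = \sum_j N i j * (A *m x r + B *m u r) j 0.
    rewrite mulmxA -NA; transitivity ((N *m (A *m x r + B *m u r)) i 0).
      by rewrite mulmxDr !mulmxA NB mul0mx addr0.
    by rewrite mxE.
  have inti j : mu.-integrable `[0, T] (EFin \o (fun r => (A *m x r + B *m u r) j 0)).
    by have [] := tr j.
  split.
    rewrite (_ : (fun r => _) = EFin \o (fun r => \sum_j N i j * (A *m x r + B *m u r) j 0)).
      by apply: (@integrable_lin _ _ (N i) (fun j r => (A *m x r + B *m u r) j 0)).
    by apply/funext => r /=; rewrite dE.
  move=> t /andP[t0 tT]; under eq_Rintegral do rewrite dE.
  rewrite (@Rintegral_lin _ _ (N i) (fun j r => (A *m x r + B *m u r) j 0))//; last first.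
    by move=> j; exact: integrable_subitv (inti j) (lexx 0) tT.
  rewrite !mxE add0r; apply: eq_bigr => j _.
  by rewrite (tr j).2 ?t0// mxE add0r.
apply/matrixP => i j; have /matrixP/(_ i 0) := N0 (delta_mx j 0).
by rewrite -colE !mxE.
Qed.

(** The rows of [N] span the kernel of [P]. Multiplying the equation by [N] on
    the left and by its transpose on the right gives [N B = 0], and then
    [N A P = 0]: the kernel is an invariant subspace, and every trajectory from
    the origin is orthogonal to it. *)
Lemma lyapunov_controllable_posdef n m (A P : 'M[R]_n) (B : 'M[R]_(n, m)) a :
  0 < a -> controllable A B -> possemidef P ->
  A *m P + P *m A^T + a *: P + a^-1 *: (B *m B^T) = 0 -> posdef P.
Proof.
move=> a0 ctrl pP lyapE.
pose N := kermx P.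
have NP : N *m P = 0 by exact: mulmx_ker.
have PN : P *m N^T = 0 by rewrite -pP.1 -trmx_mul NP trmx0.
have NAP : N *m A *m P + a^-1 *: (N *m B *m B^T) = 0.
  have := congr1 (mulmx N) lyapE.
  rewrite !mulmxDr mulmx0 -!scalemxAr !mulmxA NP mul0mx scaler0.
  by rewrite !addr0.
have NB : N *m B = 0.
  have : (N *m B) *m (N *m B)^T = 0.
    have := congr1 (mulmx^~ N^T) NAP.
    rewrite mulmxDl mul0mx -mulmxA PN mulmx0 add0r -scalemxAl => /eqP.
    rewrite scaler_eq0 invr_eq0 gt_eqF//= => /eqP h.
    by rewrite trmx_mul mulmxA.
  move=> NB2; apply/matrixP => i j.
  have : dot (row i (N *m B))^T (row i (N *m B))^T == 0.
    have /matrixP/(_ i i) := NB2; rewrite [RHS]mxE => <-.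
    by rewrite mxE dotE; apply/eqP; apply: eq_bigr => k _; rewrite !mxE.
  by rewrite dot_eq0 => /eqP/matrixP/(_ j 0); rewrite !mxE.
have : (N *m A <= N)%MS.
  apply/sub_kermxP; move: NAP; rewrite NB mul0mx scaler0 addr0.
  exact.
move=> /submxP[M NA].
have N0 : N = 0 by exact: controllable_invariant_eq0 ctrl NA NB.
have uP : P \in unitmx by rewrite -row_free_unit -kermx_eq0 -/N N0.
split=> [|v v0]; first exact: pP.1.
rewrite lt_neqAle quad_dot possemidef_dot// andbT eq_sym.
apply/negP => /eqP /(psd_quad0 pP) Pv.
by move/negP: v0; apply; rewrite -[v](mulKmx uP) Pv mulmx0.
Qed.

(** For an output Lyapunov matrix [Q], the derivative of [x^T Q x] along
    [x' = A x]. *)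
Lemma lyapQ_dissipation n k (A Q : 'M[R]_n) (C : 'M[R]_(k, n)) a y : Q^T = Q ->
  Q *m A + A^T *m Q + a *: Q + a^-1 *: (C^T *m C) = 0 ->
  2 * dot (Q *m y) (A *m y) =
    - (a * dot y (Q *m y) + a^-1 * dot (C *m y) (C *m y)).
Proof.
move=> sQ eqQ; have := lyapunov_op_quad A a y sQ.
rewrite /lyapunov_op -[Q *m A + _ + _](addrK (a^-1 *: (C^T *m C))) eqQ sub0r.
rewrite mulNmx -scalemxAl dotNr dotZr -mulmxA [dot y (C^T *m _)]dot_mulmxr trmxK.
by rewrite [dot y (Q *m (A *m y))]dot_mulmxr sQ; lra.
Qed.

(** Along [x' = A x], the form [x^T Q x] does not increase. From a vector of
    the kernel of [Q] it remains zero, and by [lyapQ_dissipation] so does the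
    output. *)
Lemma lyapunov_observable_posdef n k (A Q : 'M[R]_n) (C : 'M[R]_(k, n)) a :
  0 < a -> observable C A -> possemidef Q ->
  Q *m A + A^T *m Q + a *: Q + a^-1 *: (C^T *m C) = 0 -> posdef Q.
Proof.
move=> a0 [T T0 obs] pQ eqQ.
have Qdot y := lyapQ_dissipation y pQ.1 eqQ.
split=> [|v v0]; first exact: pQ.1.
rewrite lt_neqAle quad_dot possemidef_dot// andbT eq_sym.
apply/negP => /eqP vQ; move/negP: v0; apply; apply/eqP.
have tr t : 0 <= t -> trajectory A (0 : 'M[R]_(n, 0)) t (fun=> 0) v (flow A v).
  by move=> t0; exact: flow_trajectory.
have tr0 := @flow_trajectory _ _ A _ (0 : 'M[R]_(n, 0)) 0 T (ltW T0).
apply: (obs _ _ _ _ (tr _ (ltW T0)) tr0) => t /andP[t0 tT].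
rewrite [flow A 0 t]mulmx0 mulmx0.
have noinput (w : 'cV[R]_0) : enorm w = 0 by rewrite /enorm big_ord0 sqrtr0.
have : Num.sqrt (dot (flow A v t) (Q *m flow A v t)) <=
    Num.sqrt (dot (flow A v 0) (Q *m flow A v 0)) +
    \int[mu]_(r in `[0, t]) enorm (0 : 'cV[R]_0).
  apply: (sqrt_growth pQ t0 (tr t t0)).
    move=> y w; rewrite noinput mulr0 mul0mx addr0.
    have := Qdot y; have := mulr_ge0 (ltW a0) (possemidef_dot y pQ).
    have ai : 0 <= a^-1 by rewrite invr_ge0 ltW.
    by have := mulr_ge0 ai (dot_ge0 (C *m y)); lra.
  exact: integrable_itv_cst.
rewrite noinput Rintegral_itv_cst// mul0r addr0 flow0 vQ sqrtr0.
move=> Vt0; have Vt : dot (flow A v t) (Q *m flow A v t) <= 0.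
  by rewrite -sqrtr_eq0 eq_le Vt0 sqrtr_ge0.
have {}Vt : dot (flow A v t) (Q *m flow A v t) = 0.
  by apply/eqP; rewrite eq_le Vt possemidef_dot.
have := Qdot (flow A v t); rewrite Vt (psd_quad0 pQ Vt) dot0l !mulr0 add0r => /esym/eqP.
by rewrite oppr_eq0 mulf_eq0 invr_eq0 gt_eqF//= dot_eq0 => /eqP.
Qed.

End Reachability.

(** * Pointwise and integral bounds on the output *)

Section Norms.
Context {R : realType}.
Local Notation mu := (@lebesgue_measure R).

Lemma lebesgue_measureT_gt0 : (0 < mu [set: measurableTypeR R])%E.
Proof.
apply: (@lt_le_trans _ _ (mu `[0, 1])); last first.
  by apply: le_measure; rewrite ?inE.
apply: (@lt_le_trans _ _ 1%E) => //; rewrite le_eqVlt; apply/orP; left; apply/eqP.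
by apply/esym; apply: etrans; [exact: (lebesgue_measure_itv `[0, 1])|
   rewrite /= lte_fin ltr01 sube0].
Qed.

Lemma Lnorm_on_oo_le n (T c : R) (f : R -> 'cV[R]_n) : 0 <= c ->
  (forall t, 0 <= t <= T -> enorm (f t) <= c) ->
  (Lnorm_on T +oo%E f <= c%:E)%E.
Proof.
move=> c0 fc; rewrite /Lnorm_on unlock; case: ifP => // _.
apply/ess_supP; apply: aeW => t /=; rewrite patchE.
case: ifPn => [|_]; last by rewrite abse0 lee_fin.
rewrite inE/= in_itv/= => tT.
by rewrite lee_fin ger0_norm ?enorm_ge0// fc.
Qed.

Lemma Lnorm_on_oo_ae n (T c : R) (f : R -> 'cV[R]_n) :
  (Lnorm_on T +oo%E f <= c%:E)%E ->
  {ae mu, forall t, `[0, T]%classic t -> enorm (f t) <= c}.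
Proof.
rewrite /Lnorm_on unlock lebesgue_measureT_gt0 => /ess_supP.
apply: (@filterS _ _ (ae_filter_ringOfSetsType mu)) => t /= + Tt.
by rewrite patchE mem_set// lee_fin ger0_norm// enorm_ge0.
Qed.

Lemma Lnorm_on_1 n (T : R) (f : R -> 'cV[R]_n) :
  Lnorm_on T 1%E f = (\int[mu]_(t in `[0%R, T]) (enorm (f t))%:E)%E.
Proof.
rewrite /Lnorm_on Lnorm1 [RHS]integral_mkcond; apply: eq_integral => t _.
rewrite !patchE; case: ifPn => _; last by rewrite abse0.
by rewrite gee0_abs// lee_fin enorm_ge0.
Qed.

Lemma Lnorm_on_1_Rintegral n (T : R) (f : R -> 'cV[R]_n) :
  mu.-integrable `[0, T] (EFin \o (fun t => enorm (f t))) ->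
  Lnorm_on T 1%E f = (\int[mu]_(t in `[0, T]) enorm (f t))%:E.
Proof.
by move=> intf; rewrite Lnorm_on_1 /Rintegral fineK// integrable_fin_num.
Qed.

Lemma measurable_enorm n (T : R) (f : R -> 'cV[R]_n) : measurable_on T f ->
  measurable_fun `[0, T] (fun t => enorm (f t)).
Proof.
move=> mf; apply: (@measurableT_comp _ _ _ _ _ _ (@Num.sqrt R)).
  by apply: continuous_measurable_fun; exact: sqrt_continuous.
by apply: measurable_sum => i; exact: measurable_funX.
Qed.

Lemma Lnorm_on_1_integrable n (T c : R) (f : R -> 'cV[R]_n) : measurable_on T f ->
  (Lnorm_on T 1%E f <= c%:E)%E ->
  mu.-integrable `[0, T] (EFin \o (fun t => enorm (f t))).
Proof.
move=> mf fc; apply/integrableP; split.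
  by apply/measurable_EFinP; exact: measurable_enorm.
apply: (@le_lt_trans _ _ c%:E); last exact: ltry.
apply: le_trans fc; rewrite Lnorm_on_1 le_eqVlt; apply/orP; left; apply/eqP.
by apply: eq_integral => t _; rewrite gee0_abs// lee_fin enorm_ge0.
Qed.

End Norms.

Section InverseForm.
Context {R : realType} {n : nat} (P : 'M[R]_n).
Hypothesis pP : posdef P.
Let uP : P \in unitmx := posdef_unit pP.

Lemma invmx_possemidef : possemidef (invmx P).
Proof.
split=> [|v]; first by rewrite trmx_inv pP.1.
rewrite quad_dot -{1}[v](mulKVmx uP) dot_mulmxl pP.1.
by rewrite possemidef_dot//; exact: posdef_possemidef.
Qed.

Lemma invmx_quad y : dot y (invmx P *m y) = dot (invmx P *m y) (P *m (invmx P *m y)).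
Proof. by rewrite mulKVmx// dotC. Qed.

(** For [y = C x], Cauchy-Schwarz for the form [P] at [C^T y] and [P^-1 x] reads
    [|y|^4 <= (y^T C P C^T y) * (x^T P^-1 x)]. *)
Lemma output_le_lambda_max k (C : 'M[R]_(k, n)) x :
  dot (C *m x) (C *m x) <= lambda_max (C *m P *m C^T) * dot x (invmx P *m x).
Proof.
set y := C *m x.
have [y0|y0] := eqVneq y 0.
  rewrite y0 dot0r mulr_ge0//; last exact: possemidef_dot invmx_possemidef.
  exact/lambda_max_ge0/possemidef_congr/posdef_possemidef.
have yy : 0 < dot y y by rewrite dot_gt0.
have := cauchy_schwarz_psd (C^T *m y) (invmx P *m x) (posdef_possemidef pP).
rewrite -invmx_quad mulKVmx// -[dot (C^T *m y) x]dot_mulmxr -/y => h.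
have sC : (C *m P *m C^T)^T = C *m P *m C^T by rewrite !trmx_mul trmxK pP.1 mulmxA.
have := quad_le_lambda_max y sC.
rewrite -!mulmxA dot_mulmxr => hl.
rewrite -(ler_pM2r yy) -expr2 (le_trans h)// mulrAC ler_wpM2r//.
exact: possemidef_dot invmx_possemidef.
Qed.

End InverseForm.

Section OutputBounds.
Context {R : realType}.
Local Notation mu := (@lebesgue_measure R).
Context {n m k : nat} (A : 'M[R]_n) (B : 'M[R]_(n, m)) (C : 'M[R]_(k, n)).

Lemma trajectory_restrict T u x0 x t : trajectory A B T u x0 x -> t <= T ->
  trajectory A B t u x0 x.
Proof.
move=> tr tT i; have [inti xE] := tr i; split.
  exact: integrable_subitv inti (lexx 0) tT.
by move=> s /andP[s0 st]; rewrite xE// s0 (le_trans st).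
Qed.

Lemma trajectory0 T u x0 x : 0 <= T -> trajectory A B T u x0 x -> x 0 = x0.
Proof.
move=> T0 tr; apply/matrixP => i j; rewrite ord1 (tr i).2 ?lexx//.
by rewrite set_itv1 Rintegral_set1 addr0.
Qed.

Lemma quad_sym (P : 'M[R]_n) z : P^T = P ->
  2 * dot z (A *m (P *m z)) = dot z ((A *m P + P *m A^T) *m z).
Proof.
move=> sP; rewrite mulmxDl dotDr -!mulmxA [dot z (P *m _)]dot_mulmxr sP.
by rewrite [dot (P *m z) _]dot_mulmxr trmxK [dot (A *m _) _]dotC mulr2n mulrDl mul1r.
Qed.

(** With [z = P^-1 y], the difference of the two sides is the square
    [|B^T z - a w|^2 / a]. *)
Lemma lyapP_dissipation a P y w : 0 < a -> lyapP A B a P ->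
  2 * dot (invmx P *m y) (A *m y + B *m w) <= a * (dot w w - dot y (invmx P *m y)).
Proof.
move=> a0 [pP lyapE]; rewrite (invmx_quad pP).
rewrite -{2}[y](mulKVmx (posdef_unit pP)); set z := invmx P *m y.
rewrite dotDr mulrDr quad_sym ?pP.1//.
have /= := congr1 (fun M => dot z (M *m z)) lyapE.
rewrite mul0mx dot0r [(_ + a^-1 *: _) *m z]mulmxDl [(_ + a *: P) *m z]mulmxDl !dotDr.
rewrite -!scalemxAl !dotZr -mulmxA [dot z (B *m (B^T *m z))]dot_mulmxr.
rewrite [dot z (B *m w)]dot_mulmxr.
have ai : 0 <= a^-1 by rewrite invr_ge0 ltW.
have := mulr_ge0 ai (dot_ge0 (B^T *m z - a *: w)).
rewrite !(dotDl, dotDr, dotNl, dotNr, dotZl, dotZr) [dot w (B^T *m z)]dotC.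
move: (dot (B^T *m z) (B^T *m z)) (dot (B^T *m z) w) (dot w w) => b c d.
rewrite (_ : a^-1 * _ = a^-1 * b - 2 * c + a * d); last by field; rewrite gt_eqF.
by lra.
Qed.

Lemma admP_input_le P z : admP A B P ->
  enorm (B^T *m z) <= Num.sqrt (dot z (P *m z)).
Proof.
move=> [_ _ pPB]; rewrite enorm_dot ler_wsqrtr//.
have := possemidef_dot z pPB; rewrite mulmxBl dotDr dotNr -mulmxA.
by rewrite [dot z (B *m _)]dot_mulmxr subr_ge0.
Qed.

(** With [z = P^-1 y], the drift [z^T A P z] is nonpositive, and the input
    contributes [(B^T z) . w], where [|B^T z|^2 <= z^T P z = y^T P^-1 y]. *)
Lemma admP_dissipation P y w : admP A B P ->
  dot (invmx P *m y) (A *m y + B *m w) <=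
    Num.sqrt (dot y (invmx P *m y)) * enorm w.
Proof.
move=> admPP; have [pP pAP _] := admPP; rewrite (invmx_quad pP).
rewrite -{2}[y](mulKVmx (posdef_unit pP)); set z := invmx P *m y.
have h1 : dot z (A *m (P *m z)) <= 0.
  have := possemidef_dot z (posdef_possemidef pAP).
  by rewrite mulNmx dotNr -quad_sym ?pP.1//; lra.
rewrite dotDr [dot z (B *m w)]dot_mulmxr.
have h2 := dot_le_enorm (B^T *m z) w.
have h3 : enorm (B^T *m z) * enorm w <= Num.sqrt (dot z (P *m z)) * enorm w.
  by rewrite ler_wpM2r ?enorm_ge0// admP_input_le.
by lra.
Qed.

Lemma peak_output_le a P T y t : 0 < a -> lyapP A B a P ->
  outputs A B C +oo%E T y -> 0 <= t <= T ->
  enorm (y t) ^+ 2 <= lambda_max (C *m P *m C^T).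
Proof.
move=> a0 lP [u [x [mu_ u1 tr yE]]] /andP[t0 tT].
have pP := lP.1; rewrite yE ?t0// sqr_enorm.
apply: (le_trans (output_le_lambda_max pP C (x t))).
rewrite ler_piMr//.
  exact/lambda_max_ge0/possemidef_congr/posdef_possemidef.
apply: (@ellipsoid_invariant _ _ _ A B _ t (invmx_possemidef pP) t0 u 0 x _ a).
- exact: trajectory_restrict tr tT.
- exact: ltW.
- by move=> y' w; exact: lyapP_dissipation.
- have := Lnorm_on_oo_ae u1.
  apply: (@filterS _ _ (ae_filter_ringOfSetsType mu)) => r + rt; apply.
  by move: rt; rewrite /= !in_itv/= => /andP[-> rt]; rewrite (le_trans rt).
- by rewrite (trajectory0 (le_trans t0 tT) tr) dot0l.
Qed.

Lemma sqrt_quad_growth P T u x0 x : 0 <= T -> admP A B P ->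
  trajectory A B T u x0 x ->
  mu.-integrable `[0, T] (EFin \o (fun r => enorm (u r))) ->
  Num.sqrt (dot (x T) (invmx P *m x T)) <=
    Num.sqrt (dot x0 (invmx P *m x0)) + \int[mu]_(r in `[0, T]) enorm (u r).
Proof.
move=> T0 aP tr intu; have [pP _ _] := aP.
have := @sqrt_growth _ _ _ A B _ T (invmx_possemidef pP) T0 u x0 x tr.
rewrite (trajectory0 T0 tr); apply => // y w.
exact: admP_dissipation.
Qed.

Lemma output_le_admP P x : admP A B P -> Num.sqrt (dot x (invmx P *m x)) <= 1 ->
  enorm (C *m x) ^+ 2 <= lambda_max (C *m P *m C^T).
Proof.
move=> [pP _ _] V1; rewrite sqr_enorm (le_trans (output_le_lambda_max pP C x))//.
rewrite ler_piMr//.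
  exact/lambda_max_ge0/possemidef_congr/posdef_possemidef.
by rewrite -sqrtr1 ler_sqrt in V1.
Qed.

Lemma integral_to_peak_output_le P T y t : admP A B P ->
  outputs A B C 1%E T y -> 0 <= t <= T ->
  enorm (y t) ^+ 2 <= lambda_max (C *m P *m C^T).
Proof.
move=> aP [u [x [mu_ u1 tr yE]]] /andP[t0 tT].
have intu := Lnorm_on_1_integrable mu_ u1.
rewrite yE ?t0//; apply: output_le_admP => //.
have intut := integrable_subitv intu (lexx 0) tT.
apply: (le_trans (sqrt_quad_growth t0 aP (trajectory_restrict tr tT) intut)).
rewrite dot0l sqrtr0 add0r -lee_fin.
apply: le_trans u1; rewrite (Lnorm_on_1_Rintegral intu) lee_fin -subr_ge0.
rewrite (Rintegral_itv_sub intu)//; apply: Rintegral_ge0 => r _.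
exact: enorm_ge0.
Qed.

Lemma impulse_response_flow u0 t : impulse_response A B C u0 t = C *m flow A (B *m u0) t.
Proof. by rewrite /impulse_response /flow !mulmxA. Qed.

Lemma impulse_to_peak_output_le P u0 t : admP A B P -> enorm u0 <= 1 -> 0 <= t ->
  enorm (impulse_response A B C u0 t) ^+ 2 <= lambda_max (C *m P *m C^T).
Proof.
move=> aP u01 t0; rewrite impulse_response_flow; apply: output_le_admP => //.
have tr := @flow_trajectory _ _ A _ B (B *m u0) t t0.
have int0 : mu.-integrable `[0, t] (EFin \o (fun r : R => enorm (0 : 'cV[R]_m))).
  exact: integrable_itv_cst.
apply: (le_trans (sqrt_quad_growth t0 aP tr int0)).
rewrite Rintegral_itv_cst// enorm0 mul0r addr0.
have [pP _ _] := aP.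
set V := dot _ _.
have V0 : 0 <= V by exact: possemidef_dot (invmx_possemidef pP).
(* [V = (B^T z) . u0] for [z = P^-1 B u0], and [|B^T z| <= sqrt V]; hence
   [sqrt V <= |u0|] *)
have : V <= Num.sqrt V * enorm u0.
  rewrite {1}/V dotC dot_mulmxr (le_trans (dot_le_enorm _ _))//.
  rewrite ler_wpM2r ?enorm_ge0// /V (invmx_quad pP).
  exact: admP_input_le.
rewrite -{1}(sqr_sqrtr V0) => h.
have [->//|s0] := eqVneq (Num.sqrt V) 0.
have {}s0 : 0 < Num.sqrt V by rewrite lt_neqAle eq_sym s0 sqrtr_ge0.
by move: h; rewrite expr2 ler_pM2l// => /le_trans; apply.
Qed.

Lemma impulse_integrable u0 T : 0 <= T ->
  mu.-integrable `[0, T] (EFin \o (fun t => enorm (impulse_response A B C u0 t))).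
Proof.
move=> T0; apply: continuous_compact_integrable; first exact: segment_compact.
apply: continuous_subspaceT; apply: continuous_enorm => i.
rewrite (_ : (fun t => _) = fun t => (C *m flow A (B *m u0) t) i 0).
  by apply: continuous_mulmx => j; exact: continuous_flow.
by apply/funext => t; rewrite impulse_response_flow.
Qed.

Lemma impulse_to_integral_le a Q u0 T : 0 < a -> lyapQ A C a Q -> enorm u0 <= 1 ->
  0 <= T ->
  (\int[mu]_(t in `[0, T]) enorm (impulse_response A B C u0 t)) ^+ 2 <=
    lambda_max (B^T *m Q *m B).
Proof.
move=> a0 [pQ eqQ] u01 T0.
have psQ := posdef_possemidef pQ.
have Qdot y := lyapQ_dissipation y pQ.1 eqQ.
have tr := @flow_trajectory _ _ A _ B (B *m u0) T T0.
have := output_integral_le psQ T0 tr (C := C) a0.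
have -> : \int[mu]_(r in `[0, T]) enorm (C *m flow A (B *m u0) r) =
    \int[mu]_(t in `[0, T]) enorm (impulse_response A B C u0 t).
  by apply: eq_Rintegral => t _; rewrite impulse_response_flow.
rewrite flow0 => h.
have /h {}h : forall r, 2 * dot (Q *m flow A (B *m u0) r)
    (A *m flow A (B *m u0) r + B *m 0) <= - (a * dot (flow A (B *m u0) r)
      (Q *m flow A (B *m u0) r) + a^-1 * dot (C *m flow A (B *m u0) r) (C *m flow A (B *m u0) r)).
  by move=> r; rewrite mulmx0 addr0 Qdot.
have V0 : 0 <= dot (B *m u0) (Q *m (B *m u0)) by exact: possemidef_dot.
have psB := possemidef_congr_tr B psQ.
apply: (@le_trans _ _ (dot (B *m u0) (Q *m (B *m u0)))).
  rewrite -(sqr_sqrtr V0) ler_pXn2r// nnegrE ?sqrtr_ge0//.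
  by apply: Rintegral_ge0 => t _; exact: enorm_ge0.
rewrite dot_mulmxl !mulmxA.
apply: (le_trans (quad_le_lambda_max u0 psB.1)).
by rewrite ler_piMr ?lambda_max_ge0// -sqr_enorm expr_le1 ?enorm_ge0.
Qed.

End OutputBounds.

(** * Feasible matrices and duality *)

Section Feasibility.
Context {R : realType}.

Lemma complex_spectrum_trmx n (A : 'M[R]_n) z :
  complex_spectrum A^T z <-> complex_spectrum A z.
Proof.
rewrite /complex_spectrum/= -map_trmx !eigenvalue_root_char.
suff -> : char_poly (map_mx (real_complex R) A)^T =
  char_poly (map_mx (real_complex R) A) by [].
rewrite /char_poly -[in RHS]det_tr; congr (\det _).
by apply/matrixP => i j; rewrite !mxE eq_sym.
Qed.

Lemma alpha_range_midpoint n (A : 'M[R]_n) : (0 < n)%N -> stable A ->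
  alpha_range A (- spectral_abscissa A).
Proof.
by move=> n0 /(spectral_abscissa_lt0 n0) h; rewrite /alpha_range; apply/andP; split; lra.
Qed.

Lemma lyapunov_solution n (A S : 'M[R]_n) a : (0 < n)%N -> alpha_range A a ->
  possemidef S -> exists2 X, possemidef X & lyapunov_op A a X + S = 0.
Proof.
move=> n0 /andP[a0 ar] pS.
have Ab z : complex_spectrum A z -> complex.Re z <= - - spectral_abscissa A.
  by rewrite opprK; exact: spectral_abscissa_ge.
have ab : a / 2 < - spectral_abscissa A by lra.
have [Q pQ ltQ] := lyapunov_inequality Ab ab.
exact: (lyapunov_op_solution pQ ltQ pS).
Qed.

Lemma spectral_abscissa_trmx n (A : 'M[R]_n) :
  spectral_abscissa A^T = spectral_abscissa A.
Proof.
have AE : complex_spectrum A^T = complex_spectrum A.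
  by apply: funext => z; apply: propext; exact: complex_spectrum_trmx.
by rewrite /spectral_abscissa AE.
Qed.

Lemma possemidef_gram n m (B : 'M[R]_(n, m)) a : 0 < a ->
  possemidef (a^-1 *: (B *m B^T)).
Proof.
move=> a0; split=> [|v]; first by rewrite linearZ/= trmx_mul trmxK.
rewrite quad_dot -scalemxAl dotZr -mulmxA dot_mulmxr mulr_ge0 ?dot_ge0//.
by rewrite invr_ge0 ltW.
Qed.

Lemma lyapQ_exists n k (A : 'M[R]_n) (C : 'M[R]_(k, n)) a : (0 < n)%N ->
  alpha_range A a -> observable C A -> exists Q, lyapQ A C a Q.
Proof.
move=> n0 ar obs; have /andP[a0 _] := ar.
have pS := possemidef_gram C^T a0; rewrite trmxK in pS.
have [Q pQ eqQ] := lyapunov_solution n0 ar pS.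
by exists Q; split=> //; exact: lyapunov_observable_posdef a0 obs pQ eqQ.
Qed.

Lemma lyapP_exists n m (A : 'M[R]_n) (B : 'M[R]_(n, m)) a : (0 < n)%N ->
  alpha_range A a -> controllable A B -> exists P, lyapP A B a P.
Proof.
move=> n0 ar ctrl; have /andP[a0 _] := ar.
have arT : alpha_range A^T a by rewrite /alpha_range spectral_abscissa_trmx.
have [P pP eqP0] := lyapunov_solution n0 arT (possemidef_gram B a0).
have lyapE : A *m P + P *m A^T + a *: P + a^-1 *: (B *m B^T) = 0.
  by rewrite -eqP0 /lyapunov_op trmxK [A *m P + _]addrC.
by exists P; split=> //; exact: lyapunov_controllable_posdef a0 ctrl pP lyapE.
Qed.

Lemma posdefZ n (P : 'M[R]_n) c : 0 < c -> posdef P -> posdef (c *: P).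
Proof.
move=> c0 [sP pP]; split=> [|v v0]; first by rewrite linearZ/= sP.
by rewrite -scalemxAr -scalemxAl mxE mulr_gt0// pP.
Qed.

(** A large multiple of a solution of the Lyapunov equation dominates [C^T C]. *)
Lemma admQ_exists n k (A : 'M[R]_n) (C : 'M[R]_(k, n)) : (0 < n)%N ->
  stable A -> observable C A -> exists Q, admQ A C Q.
Proof.
move=> n0 stA obs.
have ar := alpha_range_midpoint n0 stA; have /andP[a0 _] := ar.
have [Q [pQ eqQ]] := lyapQ_exists n0 ar obs; set a := - _ in ar a0 eqQ.
have [c c0 leQ] := quad_le_posdef (C^T *m C) pQ.
exists (c *: Q); split; first exact: posdefZ.
  rewrite -scalemxAl -scalemxAr -scalerDr -scalerN; apply: posdefZ => //.
  have -> : - (Q *m A + A^T *m Q) = a *: Q + a^-1 *: (C^T *m C).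
    by apply/eqP; rewrite eq_sym -subr_eq0 opprK -eqQ addrC addrA.
  split=> [|v v0].
    by rewrite linearD/= !linearZ/= trmx_mul trmxK pQ.1.
  rewrite quad_dot mulmxDl dotDr -!scalemxAl !dotZr ltr_wpDr//.
    by rewrite -mulmxA dot_mulmxr trmxK mulr_ge0 ?dot_ge0// invr_ge0 ltW.
  by rewrite mulr_gt0// posdef_dot.
split=> [|v]; first by rewrite linearB linearZ/= trmx_mul trmxK pQ.1.
by rewrite quad_dot mulmxBl -scalemxAl dotDr dotNr dotZr subr_ge0.
Qed.

(** Pairing the first equation with [Q] and the second one with [P] gives
    [\tr (P C^T C) = \tr (Q B B^T)], since the trace is cyclic. *)
Lemma trace_lyapP_lyapQ n m k (A P Q : 'M[R]_n) (B : 'M[R]_(n, m))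
    (C : 'M[R]_(k, n)) a : 0 < a -> lyapP A B a P -> lyapQ A C a Q ->
  \tr (C *m P *m C^T) = \tr (B^T *m Q *m B).
Proof.
move=> a0 [pP eP] [pQ eQ].
have /= := congr1 (fun M => \tr (M *m Q)) eP.
have /= := congr1 (fun M => \tr (M *m P)) eQ.
rewrite !mul0mx !mulmxDl -!scalemxAl !mxtraceD !mxtraceZ mxtrace0.
have -> : \tr (C^T *m C *m P) = \tr (C *m P *m C^T).
  by rewrite -mulmxA mxtrace_mulC.
have -> : \tr (B *m B^T *m Q) = \tr (B^T *m Q *m B).
  by rewrite -mulmxA mxtrace_mulC.
have -> : \tr (Q *m A *m P) = \tr (A *m P *m Q) by rewrite -mulmxA mxtrace_mulC.
have -> : \tr (A^T *m Q *m P) = \tr (P *m A^T *m Q).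
  by rewrite mxtrace_mulC mulmxA.
have -> : \tr (Q *m P) = \tr (P *m Q) by rewrite mxtrace_mulC.
have ai : a^-1 != 0 by rewrite invr_eq0 gt_eqF.
by move=> h1 h2; apply: (mulfI ai); lra.
Qed.

(** The witness is [c *: Q^-1]. It dominates [B B^T] because [B^T Q B <= c], which
    the bound on the trace ensures, and [C Q^-1 C^T <= 1] because [C^T C <= Q]. *)
Lemma admQ_admP_inverse n m k (A Q : 'M[R]_n) (B : 'M[R]_(n, m))
    (C : 'M[R]_(k, n)) c : admQ A C Q -> 0 < c -> \tr (B^T *m Q *m B) <= c ->
  exists2 P, admP A B P & lambda_max (C *m P *m C^T) <= c.
Proof.
move=> aQ c0 trc; have [pQ pQA pQC] := aQ.
have uQ := posdef_unit pQ.
have [sI psI] := invmx_possemidef pQ.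
have psQ := posdef_possemidef pQ.
have pI : posdef (invmx Q).
  split=> // v v0; rewrite quad_dot (invmx_quad pQ) posdef_dot//.
  by apply: contra_neq v0 => h; rewrite -[v](mulKVmx uQ) h mulmx0.
exists (c *: invmx Q); last first.
  have psC := possemidef_congr C (posdef_possemidef (posdefZ c0 pI)).
  apply: lambda_max_le => //; [exact: psC.1|exact: ltW|] => y.
  rewrite -!mulmxA dot_mulmxr -scalemxAl dotZr ler_pM2l//.
  set v := C^T *m y; set w := invmx Q *m v.
  have wV : dot v w = dot w (Q *m w) by rewrite /w (invmx_quad pQ).
  have Cw : enorm (C *m w) <= Num.sqrt (dot w (Q *m w)).
    rewrite enorm_dot ler_wsqrtr//.
    have := possemidef_dot w pQC; rewrite mulmxBl dotDr dotNr -mulmxA.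
    by rewrite [dot w (C^T *m _)]dot_mulmxr trmxK subr_ge0.
  have V0 : 0 <= dot v w by rewrite wV possemidef_dot.
  have : dot v w <= Num.sqrt (dot v w) * enorm y.
    have -> : dot v w = dot y (C *m w) by rewrite /v dot_mulmxl trmxK.
    rewrite (le_trans (dot_le_enorm _ _))// mulrC ler_wpM2r ?enorm_ge0//.
    by rewrite (le_trans Cw)// -wV /v dot_mulmxl trmxK.
  rewrite -sqr_enorm -{1}(sqr_sqrtr V0) => h.
  rewrite -(sqr_sqrtr V0) ler_pXn2r ?nnegrE ?sqrtr_ge0 ?enorm_ge0//.
  have [->|s0] := eqVneq (Num.sqrt (dot v w)) 0; first exact: enorm_ge0.
  have {}s0 : 0 < Num.sqrt (dot v w) by rewrite lt_neqAle eq_sym s0 sqrtr_ge0.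
  by move: h; rewrite expr2 ler_pM2l.
split; first exact: posdefZ.
  rewrite -scalemxAl -scalemxAr -scalerDr -scalerN; apply: posdefZ => //.
  have -> : - (A *m invmx Q + invmx Q *m A^T) =
      invmx Q *m (- (Q *m A + A^T *m Q)) *m (invmx Q)^T.
    rewrite sI mulmxN mulNmx mulmxDr mulmxDl !mulmxA mulVmx// mul1mx.
    by rewrite -!mulmxA mulmxV// mulmx1.
  split=> [|v v0]; first by rewrite !trmx_mul trmxK pQA.1 mulmxA.
  rewrite quad_dot -!mulmxA dot_mulmxr; apply: posdef_dot => //.
  rewrite sI; apply: contra_neq v0 => h.
  by rewrite -[v](mulKVmx uQ) h mulmx0.
split=> [|v]; first by rewrite linearB linearZ/= trmx_mul trmxK sI.
rewrite quad_dot mulmxBl -scalemxAl dotDr dotNr dotZr subr_ge0 (invmx_quad pQ).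
rewrite -mulmxA [dot v (B *m _)]dot_mulmxr.
set w := invmx Q *m v; set b := B^T *m v.
have bE : b = B^T *m (Q *m w) by rewrite /b /w mulKVmx.
clearbody b w.
have psB := possemidef_congr_tr B psQ.
have bb : dot b b ^+ 2 <= dot b b * (c * dot w (Q *m w)).
  rewrite {2}bE dot_mulmxr trmxK (le_trans (cauchy_schwarz_psd _ _ psQ))//.
  rewrite mulrA ler_wpM2r ?possemidef_dot// dot_mulmxl !mulmxA.
  rewrite (le_trans (psd_quad_le_trace _ psB))// mulrC.
  by rewrite ler_wpM2l ?dot_ge0.
have [->|b0] := eqVneq b 0.
  by rewrite dot0l mulr_ge0 ?(ltW c0)// possemidef_dot.
by move: bb; rewrite expr2 ler_pM2l// dot_gt0.
Qed.

End Feasibility.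

Section Infima.
Context {R : realType}.

(** The margin [e] serves the comparison through [admQ_admP_inverse], which
    requires a positive bound. *)
Lemma inf_le_inf (S1 S2 : set R) : (forall c, S1 c -> 0 <= c) -> S2 !=set0 ->
  (forall c, S2 c -> forall e, 0 < e -> exists2 c', S1 c' & c' <= c + e) ->
  inf S1 <= inf S2.
Proof.
move=> S1_ge0 S20 S12; apply: lb_le_inf => // c S2c.
apply/ler_addgt0Pr => e e0; have [c' S1c' c'c] := S12 c S2c e e0.
by apply: le_trans c'c; apply: ge_inf => //; exists 0.
Qed.

Lemma le_sqrt_inf (S : set R) (r : R) : 0 <= r -> S !=set0 ->
  (forall c, S c -> r ^+ 2 <= c) -> r <= Num.sqrt (inf S).
Proof.
move=> r0 S0 Sr; rewrite -[leLHS]ger0_norm// -sqrtr_sqr ler_wsqrtr//.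
exact: lb_le_inf.
Qed.

Lemma inf_zero (S : set R) : (forall c, S c -> c = 0) -> inf S = 0.
Proof.
move=> S0; have [->|/set0P[c Sc]] := eqVneq S set0; first exact: inf0.
rewrite (_ : S = [set 0]) ?inf1//; apply/seteqP; split=> [d /S0 //|d ->].
by rewrite -(S0 c Sc).
Qed.

Lemma lambda_max_zero (M : 'M[R]_0) : lambda_max M = 0.
Proof.
have pM : possemidef M.
  by split=> [|v]; [apply/matrixP => -[]|rewrite quad_dot dotE big_ord0].
apply/eqP; rewrite eq_le lambda_max_ge0// andbT.
by rewrite (le_trans (lambda_max_le_trace pM))// /mxtrace big_ord0.
Qed.

Lemma enorm_zero (v : 'cV[R]_0) : enorm v = 0.
Proof. by rewrite /enorm big_ord0 sqrtr0. Qed.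

End Infima.

Section Comparisons.
Context {R : realType} {n m k : nat}.
Variables (A : 'M[R]_n) (B : 'M[R]_(n, m)) (C : 'M[R]_(k, n)).

Let CPC_ge0 P : posdef P -> 0 <= lambda_max (C *m P *m C^T).
Proof. by move=> pP; exact/lambda_max_ge0/possemidef_congr/posdef_possemidef. Qed.

Lemma gain_to_peak_le p c : 0 <= c ->
  (forall T y t, 0 <= T -> outputs A B C p T y -> 0 <= t <= T -> enorm (y t) <= c) ->
  (gain_to_peak A B C p <= c%:E)%E.
Proof.
move=> c0 yc; apply: ge_ereal_sup => _ [T T0 <-].
apply: ge_ereal_sup => _ [y yout <-].
by apply: Lnorm_on_oo_le => // t tT; exact: yc T0 yout tT.
Qed.

Lemma gain_impulse_le q c :
  (forall T u0, 0 <= T -> enorm u0 <= 1 ->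
     (Lnorm_on T q (impulse_response A B C u0) <= c%:E)%E) ->
  (gain_impulse A B C q <= c%:E)%E.
Proof.
move=> yc; apply: ge_ereal_sup => _ [T T0 <-].
by apply: ge_ereal_sup => _ [u0 u01 <-]; exact: yc.
Qed.

Lemma gain_impulse_oo_le c : 0 <= c ->
  (forall u0 t, enorm u0 <= 1 -> 0 <= t ->
     enorm (impulse_response A B C u0 t) <= c) ->
  (gain_impulse A B C +oo%E <= c%:E)%E.
Proof.
move=> c0 yc; apply: gain_impulse_le => T u0 T0 u01.
by apply: Lnorm_on_oo_le => // t /andP[t0 _]; exact: yc.
Qed.

Lemma gain_impulse_1_le c :
  (forall u0 T, enorm u0 <= 1 -> 0 <= T ->
     \int[@lebesgue_measure R]_(t in `[0, T]) enorm (impulse_response A B C u0 t) <= c) ->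
  (gain_impulse A B C 1%E <= c%:E)%E.
Proof.
move=> yc; apply: gain_impulse_le => T u0 T0 u01.
rewrite Lnorm_on_1_Rintegral; last exact: impulse_integrable.
by rewrite lee_fin yc.
Qed.

Lemma norm_star_le_eps : norm_star A B C <= norm_eps A B C.
Proof.
apply: ler_wsqrtr.
set S2 := (X in _ <= inf X); have [S20|/set0P S20] := eqVneq S2 set0.
  rewrite S20 (_ : [set _ | _] = set0)//; apply/seteqP; split=> // c [a [P [ar lP _]]].
  have : S2 (\tr (C *m P *m C^T)) by exists a, P.
  by rewrite S20.
apply: inf_le_inf => // [c [a [P [_ [pP _] ->]]]|c [a [P [ar lP ->]]] e e0].
  exact: CPC_ge0.
exists (lambda_max (C *m P *m C^T)); first by exists a, P.
rewrite (le_trans (lambda_max_le_trace _)) ?lerDl ?ltW//.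
exact/possemidef_congr/posdef_possemidef/lP.1.
Qed.

Lemma norm_omega_le_circ : norm_omega A B C <= norm_circ A B C.
Proof.
apply: ler_wsqrtr.
set S2 := (X in _ <= inf X); have [S20|/set0P S20] := eqVneq S2 set0.
  rewrite S20 (_ : image _ _ = set0)//; apply/seteqP; split=> // c [P aP _].
  have : S2 (\tr (C *m P *m C^T)) by exists P.
  by rewrite S20.
apply: inf_le_inf => // [c [P [pP _ _] <-]|c [P aP <-] e e0].
  exact: CPC_ge0.
exists (lambda_max (C *m P *m C^T)); first by exists P.
have [pP _ _] := aP.
rewrite (le_trans (lambda_max_le_trace _)) ?lerDl ?ltW//.
exact/possemidef_congr/posdef_possemidef.
Qed.

End Comparisons.

(** * The estimates *)

Section Estimates.
Context {R : realType} {n m k : nat}.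
Variables (A : 'M[R]_n) (B : 'M[R]_(n, m)) (C : 'M[R]_(k, n)).
Hypotheses (n0 : (0 < n)%N) (hA : stable A).
Hypotheses (hAB : controllable A B) (hCA : observable C A).

Lemma lyapP_nonempty : exists a P, alpha_range A a /\ lyapP A B a P.
Proof.
have ar := alpha_range_midpoint n0 hA.
by have [P lP] := lyapP_exists n0 ar hAB; exists (- spectral_abscissa A), P.
Qed.

Lemma lyapQ_nonempty : exists a Q, alpha_range A a /\ lyapQ A C a Q.
Proof.
have ar := alpha_range_midpoint n0 hA.
by have [Q lQ] := lyapQ_exists n0 ar hCA; exists (- spectral_abscissa A), Q.
Qed.

Lemma mxtrace_admQ_ge0 Q : admQ A C Q -> 0 <= \tr (B^T *m Q *m B).
Proof.
move=> [pQ _ _].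
exact/mxtrace_psd_ge0/possemidef_congr_tr/posdef_possemidef.
Qed.

Lemma admP_nonempty : exists P, admP A B P.
Proof.
have [Q aQ] := admQ_exists n0 hA hCA.
have c0 : 0 < \tr (B^T *m Q *m B) + 1 by rewrite ltr_wpDl// mxtrace_admQ_ge0.
have tc : \tr (B^T *m Q *m B) <= \tr (B^T *m Q *m B) + 1 by rewrite lerDl.
by have [P aP _] := admQ_admP_inverse aQ c0 tc; exists P.
Qed.

Lemma peak_to_peak_le_star :
  (gain_to_peak A B C +oo%E <= (norm_star A B C)%:E)%E.
Proof.
apply: gain_to_peak_le => [|T y t T0 yout tT]; first exact: sqrtr_ge0.
apply: le_sqrt_inf => [||c [a [P [/andP[a0 _] lP ->]]]]; first exact: enorm_ge0.
  have [a [P [ar lP]]] := lyapP_nonempty.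
  by exists (lambda_max (C *m P *m C^T)), a, P.
exact: peak_output_le a0 lP yout tT.
Qed.

Lemma impulse_to_integral_le_star' :
  (gain_impulse A B C 1%E <= (norm_star' A B C)%:E)%E.
Proof.
apply: gain_impulse_1_le => u0 T u01 T0.
apply: le_sqrt_inf => [||c [a [Q [/andP[a0 _] lQ ->]]]].
- by apply: Rintegral_ge0 => t _; exact: enorm_ge0.
- have [a [Q [ar lQ]]] := lyapQ_nonempty.
  by exists (lambda_max (B^T *m Q *m B)), a, Q.
- exact: impulse_to_integral_le a0 lQ u01 T0.
Qed.

Lemma norm_star'_le_eps : norm_star' A B C <= norm_eps A B C.
Proof.
apply: ler_wsqrtr; apply: inf_le_inf => [c [a [Q [_ [pQ _] ->]]]||].
- exact/lambda_max_ge0/possemidef_congr_tr/posdef_possemidef.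
- have [a [P [ar lP]]] := lyapP_nonempty.
  by exists (\tr (C *m P *m C^T)), a, P.
- move=> c [a [P [ar lP ->]]] e e0; have /andP[a0 _] := ar.
  have [Q lQ] := lyapQ_exists n0 ar hCA.
  exists (lambda_max (B^T *m Q *m B)); first by exists a, Q.
  rewrite (trace_lyapP_lyapQ a0 lP lQ) (le_trans (lambda_max_le_trace _)) ?lerDl ?ltW//.
  exact/possemidef_congr_tr/posdef_possemidef/lQ.1.
Qed.

Lemma integral_to_peak_le_omega :
  (gain_to_peak A B C 1%E <= (norm_omega A B C)%:E)%E.
Proof.
apply: gain_to_peak_le => [|T y t T0 yout tT]; first exact: sqrtr_ge0.
apply: le_sqrt_inf => [||c [P aP <-]]; first exact: enorm_ge0.
  have [P aP] := admP_nonempty.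
  by exists (lambda_max (C *m P *m C^T)), P.
exact: integral_to_peak_output_le aP yout tT.
Qed.

Lemma impulse_to_peak_le_omega :
  (gain_impulse A B C +oo%E <= (norm_omega A B C)%:E)%E.
Proof.
apply: gain_impulse_oo_le => [|u0 t u01 t0]; first exact: sqrtr_ge0.
apply: le_sqrt_inf => [||c [P aP <-]]; first exact: enorm_ge0.
  have [P aP] := admP_nonempty.
  by exists (lambda_max (C *m P *m C^T)), P.
exact: impulse_to_peak_output_le aP u01 t0.
Qed.

Lemma norm_omega_le_circ' : norm_omega A B C <= norm_circ' A B C.
Proof.
apply: ler_wsqrtr; apply: inf_le_inf => [c [P [pP _ _] <-]||c [Q aQ <-] e e0].
- exact/lambda_max_ge0/possemidef_congr/posdef_possemidef.
- have [Q aQ] := admQ_exists n0 hA hCA.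
  by exists (\tr (B^T *m Q *m B)), Q.
- (* the trace vanishes when [B = 0], hence the margin [e] *)
  have c0 : 0 < \tr (B^T *m Q *m B) + e by rewrite ltr_wpDl// mxtrace_admQ_ge0.
  have tc : \tr (B^T *m Q *m B) <= \tr (B^T *m Q *m B) + e by rewrite lerDl ltW.
  have [P aP lP] := admQ_admP_inverse aQ c0 tc.
  by exists (lambda_max (C *m P *m C^T)) => //; exists P.
Qed.

End Estimates.

(** In dimension [0] the spectrum is empty, so is the range of [a], and the
    existence lemmas fail; but all outputs and all infima of [lambda_max] vanish. *)
Section ZeroDimensional.
Context {R : realType} (n : nat).
Variables (A : 'M[R]_n) (B : 'M[R]_(n, 0)) (C : 'M[R]_(0, n)).

Lemma gain_to_peak_dim0 p c : 0 <= c -> (gain_to_peak A B C p <= c%:E)%E.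
Proof. by move=> c0; apply: gain_to_peak_le => // *; rewrite enorm_zero. Qed.

Lemma gain_impulse_1_dim0 c : 0 <= c -> (gain_impulse A B C 1%E <= c%:E)%E.
Proof.
move=> c0; apply: gain_impulse_1_le => u0 T _ T0.
under eq_Rintegral do rewrite enorm_zero.
by rewrite Rintegral_itv_cst// mul0r.
Qed.

Lemma gain_impulse_oo_dim0 c : 0 <= c -> (gain_impulse A B C +oo%E <= c%:E)%E.
Proof. by move=> c0; apply: gain_impulse_oo_le => // *; rewrite enorm_zero. Qed.

Lemma norm_star'_dim0 : norm_star' A B C = 0.
Proof.
rewrite /norm_star' inf_zero ?sqrtr0// => c [a [Q [_ _ ->]]].
exact: lambda_max_zero.
Qed.

Lemma norm_omega_dim0 : norm_omega A B C = 0.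
Proof.
rewrite /norm_omega inf_zero ?sqrtr0// => c [P _ <-].
exact: lambda_max_zero.
Qed.

End ZeroDimensional.

Theorem theorem5 (R : realType) (n m k : nat)
    (A : 'M[R]_n) (B : 'M[R]_(n, m)) (C : 'M[R]_(k, n))
    (hA : stable A) (hAB : controllable A B) (hCA : observable C A)
    (hB : \rank B = m) (hC : \rank C = k) :
  [/\ (gain_to_peak A B C +oo%E <= (norm_star A B C)%:E <= (norm_eps A B C)%:E)%E,
      (gain_impulse A B C 1%E <= (norm_star' A B C)%:E <= (norm_eps A B C)%:E)%E,
      (gain_to_peak A B C 1%E <= (norm_omega A B C)%:E <= (norm_circ A B C)%:E)%E &
      (gain_impulse A B C +oo%E <= (norm_omega A B C)%:E <= (norm_circ' A B C)%:E)%E].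
Proof.
have [n0|n0] := posnP n.
  have m0 : m = 0%N by apply/eqP; rewrite -leqn0 -hB -n0 rank_leq_row.
  have k0 : k = 0%N by apply/eqP; rewrite -leqn0 -hC -n0 rank_leq_col.
  subst m k.
  split; apply/andP; split.
  - by apply: gain_to_peak_dim0; exact: sqrtr_ge0.
  - by rewrite lee_fin; exact: norm_star_le_eps.
  - by rewrite norm_star'_dim0; exact: gain_impulse_1_dim0.
  - by rewrite norm_star'_dim0 lee_fin; exact: sqrtr_ge0.
  - by rewrite norm_omega_dim0; exact: gain_to_peak_dim0.
  - by rewrite lee_fin; exact: norm_omega_le_circ.
  - by rewrite norm_omega_dim0; exact: gain_impulse_oo_dim0.
  - by rewrite norm_omega_dim0 lee_fin; exact: sqrtr_ge0.
split; apply/andP; split.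
- exact: peak_to_peak_le_star.
- by rewrite lee_fin; exact: norm_star_le_eps.
- exact: impulse_to_integral_le_star'.
- by rewrite lee_fin; exact: norm_star'_le_eps.
- exact: integral_to_peak_le_omega.
- by rewrite lee_fin; exact: norm_omega_le_circ.
- exact: impulse_to_peak_le_omega.
- by rewrite lee_fin; exact: norm_omega_le_circ'.
Qed.
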